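(* For $n\ge2$ let $$P_n(w)=\tfrac12N_S(0,n)+\sum_{1\le m<n}N_S(m,n)w^m.$$ As $n\to\infty$, the roots of $P_n(w)$ tend to equidistribution on the unit circle.
   Context: Let $\mathcal{P}$ be the set of integer partitions (including the empty one) and $\mathcal{D}\subset\mathcal{P}$ the set of partitions into distinct parts. For a partition $\pi$, let $\#(\pi)$ be its number of parts, $|\pi|$ the sum of its parts, and $s(\pi)$ its smallest part, with $s(\emptyset)=\infty$. Let $S$ be the set of vector partitions $\vec\pi=(\pi_1,\pi_2,\pi_3)\in\mathcal{D}\times\mathcal{P}\times\mathcal{P}$ with $1\le s(\pi_1)<\infty$ and $s(\pi_1)\le\min(s(\pi_2),s(\pi_3))$. Put $|\vec\pi|=|\pi_1|+|\pi_2|+|\pi_3|$, $\operatorname{crank}(\vec\pi)=\#(\pi_2)-\#(\pi_3)$, and $\omega_1(\vec\pi)=(-1)^{\#(\pi_1)-1}$. Define $$N_S(m,n)=\sum_{\substack{\vec\pi\in S,\ |\vec\pi|=n\\ \operatorname{crank}(\vec\pi)=m}}\omega_1(\vec\pi).$$ Equivalently, $$\sum_{n\ge1}\sum_{m\in\mathbb{Z}}N_S(m,n)w^mq^n=\sum_{n\ge1}\frac{q^n(q^{n+1};q)_\infty}{(wq^n;q)_\infty(w^{-1}q^n;q)_\infty},\qquad (a;q)_\infty=\prod_{k\ge0}(1-aq^k).$$ For a polynomial $f$ of degree $d\ge1$ with roots $z_1,\dots,z_d\in\mathbb{C}$ listed with multiplicity, let $\mu_{\{f\}}=\frac1d\sum_{j=1}^d\delta_{z_j}$,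 where $\delta_z$ is the Dirac measure at $z$. The roots of a sequence of polynomials $f_n$ tend to equidistribution on the unit circle as $n\to\infty$ if $\mu_{\{f_n\}}$ converges weakly, as measures on $\mathbb{C}$, to the normalized Haar (uniform probability) measure on $\{|z|=1\}$. *)

(* Defs.v *)
From HB Require Import structures.
From mathcomp Require Import all_boot all_order all_algebra.
From mathcomp Require Import complex.
From mathcomp Require Import all_classical all_reals all_analysis.
Set Implicit Arguments.
Unset Strict Implicit.
Unset Printing Implicit Defensive.
Import Order.TTheory GRing.Theory Num.Theory.
Import numFieldNormedType.Exports.

Local Open Scope classical_set_scope.
Local Open Scope ring_scope.

(* A partition is the weakly decreasing sequence of its (positive) parts: its
   number of parts is [size] and the sum of its parts is [sumn]. *)
Definition is_partition (p : seq nat) : bool :=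
  sorted geq p && all (fun i => 0 < i)%N p.

Definition is_distinct_partition (p : seq nat) : bool :=
  is_partition p && uniq p.

Definition smallest_part (p : seq nat) : \bar int :=
  \big[Order.min/+oo%E]_(i <- p) (i%:Z)%:E.

Definition vpart : Type := (seq nat * seq nat * seq nat)%type.

Definition in_S (v : vpart) : bool :=
  let: (p1, p2, p3) := v in
  [&& is_distinct_partition p1, is_partition p2, is_partition p3,
      (1%:E <= smallest_part p1 < +oo)%E &
      (smallest_part p1 <= Order.min (smallest_part p2) (smallest_part p3))%E].

Definition vweight (v : vpart) : nat :=
  let: (p1, p2, p3) := v in (sumn p1 + sumn p2 + sumn p3)%N.

Definition crank (v : vpart) : int :=
  let: (_, p2, p3) := v in (size p2)%:Z - (size p3)%:Z.

(* The exponent #(pi_1) - 1 is not truncated on S, where pi_1 is nonempty. *)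
Definition omega1 (v : vpart) : int :=
  let: (p1, _, _) := v in (-1) ^+ (size p1).-1.

Definition S_of (m : int) (n : nat) : set vpart :=
  [set v | [/\ in_S v, vweight v = n & crank v = m]].

(* [\sum_(v \in A)] is 0 when the support of the summand in A is infinite; here
   the index set is finite, see [finite_S_of]. *)
Definition N_S (m : int) (n : nat) : int := \sum_(v \in S_of m n) omega1 v.

Lemma partition_size_sumn p : is_partition p -> (size p <= sumn p)%N.
Proof.
case/andP=> _; elim: p => //= a p IH /andP[a0 /IH].
by move=> h; rewrite -add1n leq_add.
Qed.

Lemma finite_partitions n :
  finite_set [set p : seq nat | is_partition p /\ (sumn p <= n)%N].
Proof.
pose T : finType := {k : 'I_n.+1 & k.-tuple 'I_n.+1}.
pose F (t : T) : seq nat := [seq val i | i <- tagged t].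
apply: (@sub_finite_set _ _ (F @` setT)); last first.
  by apply: finite_image; exact: finite_finset.
move=> p [pp pn].
have sp : (size p < n.+1)%N.
  by rewrite ltnS (leq_trans _ pn)// partition_size_sumn.
have st : size [seq (inord i : 'I_n.+1) | i <- p] == Ordinal sp.
  by rewrite size_map.
exists (Tagged (fun k : 'I_n.+1 => k.-tuple 'I_n.+1) (Tuple st)) => //.
rewrite /F /= -map_comp map_id_in// => i ip /=.
rewrite inordK// ltnS (leq_trans _ pn)//.
by elim: p ip {pp pn sp st} => //= a p IH; rewrite inE => /orP[/eqP ->|/IH];
  [rewrite leq_addr|move=> h; rewrite (leq_trans h)// leq_addl].
Qed.

Lemma finite_S_of m n : finite_set (S_of m n).
Proof.
have fp := finite_partitions n.
apply: (sub_finite_set _ (finite_setX (finite_setX fp fp) fp)).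
move=> [[p1 p2] p3] [/= /and5P[/andP[h1 _] h2 h3 _ _] <- _].
split=> /=; first split=> /=.
- by split=> //; rewrite -addnA leq_addr.
- by split=> //; rewrite addnAC leq_addl.
- by split=> //; rewrite leq_addl.
Qed.

Definition P_ (R : realType) (n : nat) : {poly R[i]} :=
  ((N_S 0 n)%:~R / 2)%:P + \sum_(1 <= m < n) (N_S m n)%:~R *: 'X^m.

(* The library puts the usual topology of the complex numbers on R[i]^o, an
   alias of R[i]. *)
Notation borel T := (g_sigma_algebraType (@open T)).
Notation borelC R := (borel (R[i])^o).

Definition weak_cvg (R : realType) (T : ptopologicalType)
    (mu_ : nat -> {measure set (borel T) -> \bar R})
    (mu : {measure set (borel T) -> \bar R}) : Prop :=
  forall f : T -> R, continuous f -> bounded_fun f ->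
    (\int[mu_ n]_x (f x)%:E)%E @[n --> \oo] --> (\int[mu]_x (f x)%:E)%E.

(* The roots of f, listed with multiplicity (arbitrary when f = 0). *)
Definition poly_roots (R : realType) (f : {poly R[i]}) : seq R[i] :=
  sval (closed_field_poly_normal f).

(* For constant f the factor is 0^-1 = 0 and the sum is empty. *)
Definition root_measure (R : realType) (f : {poly R[i]}) :
    {measure set (borelC R) -> \bar R} :=
  let d := (size f).-1 in
  mscale ((d%:R : R)^-1)%:nng
    (msum (fun j => dirac ((poly_roots f)`_j : borelC R)) d).

Definition expi (R : realType) (t : measurableTypeR R) : borelC R :=
  Complex (cos t) (sin t).

Lemma continuous_expi (R : realType) : continuous (@expi R : R -> (R[i])^o).
Proof.
have cC (f : R -> R) : continuous f ->
    continuous (fun x => real_complex R (f x) : (R[i])^o).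
  move=> cf t; apply/cvgrPdist_lt => e e0.
  have eE : e = real_complex R (complex.Re e).
    by rewrite RRe_real// gtr0_real.
  have e'0 : 0 < complex.Re e by move: e0; rewrite ltcE => /andP[].
  have /cvgrPdist_lt /(_ _ e'0) := cf t.
  apply: filterS => s.
  move=> fts; rewrite -[X in `|X|]/(real_complex R (f t) - real_complex R (f s)).
  by rewrite -rmorphB normc_def /= expr0n /= addr0 sqrtr_sqr eE ltcR.
have -> : (@expi R : R -> (R[i])^o) = (fun t : R =>
    (real_complex R (cos t) : (R[i])^o) +
    (Complex 0 1 : (R[i])^o) * (real_complex R (sin t) : (R[i])^o)).
  by apply/funext => t; rewrite /expi; simpc.
move=> t; apply: cvgD; first exact: (cC _ (@continuous_cos R)).
by apply: cvgMr; exact: (cC _ (@continuous_sin R)).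
Qed.

Lemma measurable_expi (R : realType) :
  measurable_fun [set: measurableTypeR R] (@expi R).
Proof.
apply: (@measurability _ _ (measurableTypeR R) (borelC R) setT (@expi R)
  (@open (R[i])^o)) => //.
move=> _ [U oU <-]; rewrite setTI; apply: measurable_realfun.open_measurable.
by apply: open_comp oU => t _; exact: continuous_expi.
Qed.

HB.instance Definition _ (R : realType) :=
  isMeasurableFun.Build _ _ _ _ (@expi R) (@measurable_expi R).

Lemma two_pi_gt0 (R : realType) : 0 < 2 * pi :> R.
Proof. by rewrite mulr_gt0// pi_gt0. Qed.

(* The normalized Haar measure of the unit circle, as a measure on the plane:
   the law of cos t + i sin t for t uniform on [0, 2 pi]. *)
Definition circle_measure (R : realType) : {measure set (borelC R) -> \bar R} :=
  distribution (uniform_prob (two_pi_gt0 R)) (@expi R).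

Definition roots_equidistribute (R : realType) (f : nat -> {poly R[i]}) : Prop :=
  weak_cvg (fun n => root_measure (f n)) (circle_measure R).

(* Main.v *)
Require Import Defs.
From HB Require Import structures.
From mathcomp Require Import all_boot all_order all_algebra.
From mathcomp Require Import complex.
From mathcomp Require Import all_classical all_reals all_analysis.
From mathcomp Require Import qpoly measurable_realfun.
From mathcomp Require Import ring lra zify.

(** Erdos-Turan type equidistribution: if the coefficients of a polynomial of
    degree d are e^(o(d)) relative to the leading one, and its lowest nonzero
    coefficient has index o(d) and is at least e^(-o(d)), then its roots z are
    asymptotically uniform on the circle.  Let b(z) be conj z if |z| <= 1 and
    1/z otherwise.  On the circle |prod (1 - b(z) x)| prod max(1, |z|) is the
    modulus of the monic polynomial, so bounding coefficients by the maximum on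
    the circle gives prod max(1, |z|) <= e^(o(d)) (hence most roots are near the
    circle) and |prod (1 - b(z) x)| <= e^(o(d)) on the disc.  Multiplying over
    the k-th roots of unity turns the latter into a bound for
    prod (1 - b(z)^k v), and comparing with exp (- Re (v sum b(z)^k)) for small
    v shows that every power sum of the b(z) is o(d).  Weyl's criterion, in the
    form of discrete Fejer sums, concludes.

    For P_n the upper bound is elementary, and the coefficients N_S(m, n) with
    2n <= (m+1)^2 are positive: if H_m(x) = sum_j x^j / ((q)_(m+j) (q)_j), then
    K_m(x) = (x; q)_oo H_m(x) satisfies
    K_m(x) = K_m(xq) + x q^(m+1) K_(m+1)(xq), and the terms of the generating
    function of N_S(m, .) are
    q^(n(m+1)) (q^(n+1); q)_(n-1) K_m(q^(2n)), where the finite product is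
    absorbed by the initial value K_m(0) = 1 / (q)_m as soon as 2n <= m+1; the
    other n contribute only beyond degree n(m+1). *)

Set Implicit Arguments.
Unset Strict Implicit.
Unset Printing Implicit Defensive.
Import Order.TTheory GRing.Theory Num.Theory.
Import numFieldNormedType.Exports.
Import ComplexField.Normc.
Local Open Scope classical_set_scope.
Local Open Scope ring_scope.

(** * Truncated q-series *)

Section TruncatedSeries.
Variables (A : comNzRingType) (q : A) (N : nat).

(** Positivity of a q-series phrased without coefficients, since A is an abstract ring;
    [coef_qnonneg] recovers the numerical statement. *)
Definition qnonneg (x : A) : Prop :=
  exists2 p : {poly int}, (forall i, 0 <= p`_i) & x = (map_poly intr p).[q].

Lemma qnonneg0 : qnonneg 0.
Proof. by exists 0 => [i|]; rewrite ?coef0// rmorph0 horner0. Qed.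

Lemma qnonnegD x y : qnonneg x -> qnonneg y -> qnonneg (x + y).
Proof.
move=> [p hp ->] [r hr ->]; exists (p + r); last by rewrite rmorphD hornerD.
by move=> i; rewrite coefD addr_ge0.
Qed.

Lemma qnonnegM x y : qnonneg x -> qnonneg y -> qnonneg (x * y).
Proof.
move=> [p hp ->] [r hr ->]; exists (p * r); last by rewrite rmorphM hornerM.
by move=> i; rewrite coefM sumr_ge0// => j _; rewrite mulr_ge0.
Qed.

Lemma qnonneg_exp i : qnonneg (q ^+ i).
Proof.
by exists 'X^i => [j|]; rewrite ?coefXn ?ler0n// map_polyXn hornerXn.
Qed.

Lemma qnonneg_sum (I : Type) (r : seq I) (P : pred I) (F : I -> A) :
  (forall i, P i -> qnonneg (F i)) -> qnonneg (\sum_(i <- r | P i) F i).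
Proof.
by move=> h; elim/big_ind: _ => //; [exact: qnonneg0|move=> *; exact: qnonnegD].
Qed.

Lemma qnonneg_prod (I : Type) (r : seq I) (P : pred I) (F : I -> A) :
  (forall i, P i -> qnonneg (F i)) -> qnonneg (\prod_(i <- r | P i) F i).
Proof.
move=> h; elim/big_ind: _ => //; last by move=> *; exact: qnonnegM.
by rewrite -(expr0 q); exact: qnonneg_exp.
Qed.

(** Series are taken modulo q^(N+1): infinite sums and products become finite ones, and the
    coefficient of q^N is kept. *)
Hypothesis qN : q ^+ N.+1 = 0.

Lemma expq_eq0 i : (N < i)%N -> q ^+ i = 0.
Proof. by move=> h; rewrite -(subnK h) exprD qN mulr0. Qed.

Definition geom i : A := \sum_(k < N.+1) (q ^+ i) ^+ k.

Lemma geomV i : (0 < i)%N -> (1 - q ^+ i) * geom i = 1.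
Proof.
move=> i0; rewrite /geom -opprB mulNr -subrX1 -exprM expq_eq0 ?sub0r ?opprK//.
by rewrite (leq_trans (ltnSn N))// leq_pmull.
Qed.

Lemma qnonneg_geom i : qnonneg (geom i).
Proof. by apply: qnonneg_sum => k _; rewrite -exprM; exact: qnonneg_exp. Qed.

(* [iqfact k] is 1 / (q; q)_k. *)
Definition iqfact k : A := \prod_(1 <= i < k.+1) geom i.

Lemma iqfact0 : iqfact 0 = 1.
Proof. by rewrite /iqfact big_geq. Qed.

Lemma iqfactS k : (1 - q ^+ k.+1) * iqfact k.+1 = iqfact k.
Proof. by rewrite /iqfact [in LHS]big_nat_recr//= mulrCA geomV// mulr1. Qed.

Lemma qnonneg_iqfact k : qnonneg (iqfact k).
Proof. by apply: qnonneg_prod => i _; exact: qnonneg_geom. Qed.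

(* [hsum m i] is sum_j x^j / ((q; q)_(m+j) (q; q)_j) at x = q^i, for i > 0. *)
Definition hsum m i : A :=
  \sum_(j < N.+1) q ^+ (i * j) * (iqfact (m + j) * iqfact j).

(** With x = q^i, the factor 1 - q^j in H_m(x) - H_m(xq) cancels against 1 / (q; q)_j and the index
    shifts by one; the leftover top term vanishes because q^(N+1) = 0. *)
Lemma hsum_shift_x m i : (0 < i)%N ->
  hsum m i = hsum m i.+1 + q ^+ i * hsum m.+1 i.
Proof.
move=> i0; apply/eqP; rewrite addrC -subr_eq; apply/eqP.
rewrite /hsum -sumrB mulr_sumr big_ord_recl/= !muln0 subrr add0r.
rewrite [RHS]big_ord_recr/= mulrA -exprD [X in _ + X * _]expq_eq0; last first.
  by rewrite (leq_trans (ltnSn N))// -mulnS leq_pmull.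
rewrite mul0r addr0; apply: eq_bigr => j _; rewrite /bump/= !add1n.
rewrite -(iqfactS j) addnS addSn mulSn (addnC j.+1) exprD mulnS exprD.
ring.
Qed.

(** Termwise, from 1 / (q; q)_(m+j) = (1 - q^(m+1+j)) / (q; q)_(m+1+j). *)
Lemma hsum_shift_m m i :
  hsum m.+1 i = hsum m i + q ^+ m.+1 * hsum m.+1 i.+1.
Proof.
rewrite /hsum mulr_sumr -big_split/=; apply: eq_bigr => j _.
rewrite addSn -(iqfactS (m + j)) mulSn -addSn !exprD; ring.
Qed.

(** This is (q^i; q)_oo, whose factors with l > N equal 1. *)
Definition qpoch i : A := \prod_(i <= l < N.+1) (1 - q ^+ l).

Definition ksum m i : A := qpoch i * hsum m i.

Lemma ksum_rec m i : (0 < i <= N)%N ->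
  ksum m i = ksum m i.+1 + q ^+ (i + m.+1) * ksum m.+1 i.+1.
Proof.
move=> /andP[i0 iN]; rewrite /ksum /qpoch big_ltn//=.
have: (1 - q ^+ i) * hsum m i = hsum m i.+1 + q ^+ (i + m.+1) * hsum m.+1 i.+1.
  rewrite mulrBl mul1r {1}hsum_shift_x// hsum_shift_m exprD; ring.
by move=> h; rewrite mulrAC h; ring.
Qed.

Lemma ksum_big m i : (N < i)%N -> ksum m i = iqfact m.
Proof.
move=> Ni; rewrite /ksum /qpoch big_geq// mul1r /hsum big_ord_recl/=.
rewrite muln0 expr0 mul1r addn0 iqfact0 mulr1 big1 ?addr0// => j _.
by rewrite expq_eq0 ?mul0r// (leq_trans Ni)// leq_pmulr.
Qed.

(** Iterating [ksum_rec] until q^i = 0 expresses K_m(q^i) through powers of q and initial values 1 /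
    (q; q)_k with k >= m. The factor c may have negative coefficients: it is absorbed by each
    initial value separately. *)
Lemma qnonneg_ksum (c : A) m0 :
  (forall m, (m0 <= m)%N -> qnonneg (c * iqfact m)) ->
  forall i m, (0 < i)%N -> (m0 <= m)%N ->
  exists2 x, qnonneg x & c * ksum m i = c * iqfact m + x.
Proof.
move=> hc i m i0; have [k] := ubnP (N.+1 - i); elim: k i m i0 => // k IH i m i0.
rewrite ltnS => hk hm; have [iN|Ni] := leqP i N; last first.
  by exists 0; [exact: qnonneg0|rewrite ksum_big// addr0].
have hk' : (N.+1 - i.+1 < k)%N by lia.
rewrite ksum_rec ?i0//; have [//|x hx ex] := IH _ _ _ hk' hm.
have [//|//|y hy ey] := IH i.+1 m.+1 _ hk'; first exact: leqW.
exists (x + q ^+ (i + m.+1) * (c * iqfact m.+1 + y)).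
  by apply: qnonnegD => //; apply: qnonnegM; [exact: qnonneg_exp|
    apply: qnonnegD => //; apply: hc; exact: leqW].
by rewrite mulrDr (mulrCA c (q ^+ _)) ey ex addrA.
Qed.

(** Every factor 1 - q^l here occurs in (q; q)_m, and what remains of the inverse is a product of
    geometric series. *)
Lemma qnonneg_prod_iqfact a b m : (0 < a)%N -> (b <= m.+1)%N ->
  qnonneg (\prod_(a <= l < b) (1 - q ^+ l) * iqfact m).
Proof.
move=> a0 bm; have [ab|ba] := leqP a b; last first.
  by rewrite big_geq ?(ltnW ba)// mul1r; exact: qnonneg_iqfact.
rewrite /iqfact [X in _ * X](@big_cat_nat _ _ _ a)//=; last exact: leq_trans ab bm.
rewrite [X in _ * (_ * X)](@big_cat_nat _ _ _ b)//= mulrCA.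
apply: qnonnegM; first by apply: qnonneg_prod => *; exact: qnonneg_geom.
rewrite mulrA -big_split/= big_nat big1 => [|i /andP[ai _]]; last first.
  by rewrite geomV// (leq_trans a0).
by rewrite mul1r; apply: qnonneg_prod => *; exact: qnonneg_geom.
Qed.

(* The terms of the generating function: n is the smallest part of pi_1. *)
Definition gterm m n : A :=
  q ^+ n * \prod_(n.+1 <= l < N.+1) (1 - q ^+ l) * (q ^+ (n * m) * hsum m n.*2).

Lemma gterm_split m n : (0 < n)%N -> (n.*2 <= N.+1)%N ->
  gterm m n =
  q ^+ (n * m.+1) * (\prod_(n.+1 <= l < n.*2) (1 - q ^+ l) * ksum m n.*2).
Proof.
move=> n0 nN; rewrite /gterm (@big_cat_nat _ _ _ n.*2)//=; last by lia.
by rewrite /ksum /qpoch mulnS exprD; ring.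
Qed.

Lemma gterm_big m n : (N < n * m.+1)%N -> gterm m n = 0.
Proof.
by move=> h; rewrite /gterm mulrAC mulrA -exprD -mulnS expq_eq0// !mul0r.
Qed.

Lemma gterm_qnonneg m n : (0 < n)%N -> (2 * N <= m.+1 ^ 2)%N ->
  qnonneg (gterm m n).
Proof.
move=> n0 hm; have [h|h] := leqP (n * m.+1) N; last first.
  by rewrite gterm_big//; exact: qnonneg0.
(* Indeed 2n(m+1) <= 2N <= (m+1)^2. The factors 1 - q^l with l < 2n can then be absorbed by 1 / (q;
   q)_m. *)
have nm : (2 * n <= m.+1)%N.
  rewrite -(@leq_pmul2r m.+1)// mulnn; apply: leq_trans hm.
  by rewrite -mulnA leq_mul2l.
rewrite gterm_split//; last by have : (n * (2 * n) <= n * m.+1)%N; nia.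
have hc k : (m <= k)%N ->
    qnonneg (\prod_(n.+1 <= l < n.*2) (1 - q ^+ l) * iqfact k).
  by move=> mk; apply: qnonneg_prod_iqfact => //; lia.
have [||x hx ->] := qnonneg_ksum hc (i := n.*2) (m := m) => //; first lia.
apply: qnonnegM; first exact: qnonneg_exp.
by apply: qnonnegD => //; exact: hc.
Qed.

(** The term n = 1 supplies strict positivity: its finite product is empty, and q^(m+1) K_m(0)
    splits off. *)
Lemma gterm1 m : (0 < m)%N -> (2 * N <= m.+1 ^ 2)%N ->
  exists2 x, qnonneg x & gterm m 1 = q ^+ m.+1 * iqfact m + x.
Proof.
move=> m0 hm; have [N0|N0] := posnP N.
  exists 0; first exact: qnonneg0.
  rewrite gterm_big ?N0 ?mul1n//.
  by rewrite expq_eq0 ?N0// mul0r addr0.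
rewrite gterm_split// big_geq// mul1r mul1n.
have hc k : (m <= k)%N -> qnonneg (1 * iqfact k).
  by rewrite mul1r => _; exact: qnonneg_iqfact.
have [||x hx] := qnonneg_ksum hc (i := 2) (m := m) => //.
rewrite !mul1r => ->; exists (q ^+ m.+1 * x); last by rewrite mulrDr.
by apply: qnonnegM => //; exact: qnonneg_exp.
Qed.

(** The factor 1 / (1 - q) is isolated because all its coefficients are 1, so that q^(m+1) / (1 - q)
    has coefficient 1 at q^N when m < N. *)
Lemma iqfact_geom1 m : (0 < m)%N ->
  exists2 x, qnonneg x & iqfact m = geom 1 + x.
Proof.
move=> m0; exists (geom 1 * (\prod_(2 <= i < m.+1) geom i - 1)); last first.
  by rewrite /iqfact big_ltn// mulrBr mulr1 addrC subrK.
apply: qnonnegM; first exact: qnonneg_geom.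
elim: m m0 => // -[|m] IH _; first by rewrite big_geq// subrr; exact: qnonneg0.
rewrite big_nat_recr//=; set g := geom _; set P := \prod_(_ <= _ < _) _.
have -> : P * g - 1 = (P - 1) * g + (g - 1) by ring.
apply: qnonnegD; first by apply: qnonnegM; [exact: IH|exact: qnonneg_geom].
rewrite /g /geom big_ord_recl expr0 addrC addKr.
by apply: qnonneg_sum => k _; rewrite -exprM; exact: qnonneg_exp.
Qed.

Section Coefficient.
Variable coef : {additive A -> int}.
Hypothesis coef_exp : forall w, coef (q ^+ w) = (w == N)%:R.

Lemma coef_qnonneg x : qnonneg x -> 0 <= coef x.
Proof.
move=> [p hp ->]; rewrite horner_coef raddf_sum sumr_ge0// => i _.
rewrite coef_map/= mulrzl raddfMz coef_exp.
by case: eqP => _; rewrite ?mul0rz// mulrzz mul1r.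
Qed.

Lemma coef_gterm m n : (0 < n)%N -> (2 * N <= m.+1 ^ 2)%N ->
  0 <= coef (gterm m n).
Proof. by move=> n0 hm; apply: coef_qnonneg; exact: gterm_qnonneg. Qed.

Lemma coef_gterm1 m : (0 < m < N)%N -> (2 * N <= m.+1 ^ 2)%N ->
  1 <= coef (gterm m 1).
Proof.
move=> /andP[m0 mN] hm; have [x hx ->] := gterm1 m0 hm.
have [y hy ->] := iqfact_geom1 m0.
rewrite raddfD/= -[1]addr0 lerD ?coef_qnonneg// mulrDr raddfD/= -[1]addr0 lerD//.
  rewrite /geom mulr_sumr raddf_sum/=.
  have h : (N - m.+1 < N.+1)%N by lia.
  rewrite (bigD1 (Ordinal h))//= -exprM -exprD mul1n subnKC// coef_exp eqxx.
  rewrite lerDl sumr_ge0// => k _; rewrite -exprM -exprD coef_exp.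
  exact: ler0n.
by apply: coef_qnonneg; apply: qnonnegM => //; exact: qnonneg_exp.
Qed.

End Coefficient.

Lemma coef_sum_gterm_gt0 (coef : {additive A -> int}) m :
  (forall w, coef (q ^+ w) = (w == N)%:R) ->
  (0 < m < N)%N -> (2 * N <= m.+1 ^ 2)%N ->
  0 < coef (\sum_(1 <= n < N.+1) gterm m n).
Proof.
move=> hc hmN hm; rewrite big_ltn; last by lia.
rewrite raddfD/= (lt_le_trans (ltr01))// -[1]addr0 lerD ?coef_gterm1//.
rewrite raddf_sum big_nat sumr_ge0// => n /andP[n0 _].
by apply: coef_gterm => //; exact: leq_trans n0.
Qed.

End TruncatedSeries.

(** The ring is Z[X] / (X^(N+1)), with the coefficient of X^N in the reduced representative. *)
Lemma truncated_series_exists N : exists (A : comNzRingType) (q : A)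
  (coef : {additive A -> int}),
  q ^+ N.+1 = 0 /\ forall w, coef (q ^+ w) = (w == N)%:R.
Proof.
pose h : {poly int} := 'X^(N.+1).
have hE : mk_monic h = 'X^(N.+1) by rewrite mk_monic_Xn.
have qE w : in_qpoly h 'X ^+ w = in_qpoly h 'X^w by rewrite rmorphXn.
have q0 w : (N < w)%N -> in_qpoly h 'X ^+ w = 0.
  move=> Nw; rewrite qE -(subnK Nw) exprD rmorphM/=; apply/eqP.
  rewrite [X in _ * X](_ : _ = 0) ?mulr0//.
  by apply/val_inj; rewrite /= hE Pdiv.RingMonic.rmodpp// monicXn.
have coefD : additive (fun x : {poly %/ h} => (x : {poly int})`_N).
  by move=> x y; rewrite /= coefB.
pose cA := GRing.isAdditive.Build _ _ _ coefD.
pose c : {additive {poly %/ h} -> int} :=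
  HB.pack (fun x : {poly %/ h} => (x : {poly int})`_N) cA.
exists {poly %/ h}, (in_qpoly h 'X), c; split; first exact: q0.
move=> w; have [wN|Nw] := leqP w N; last first.
  by rewrite q0// raddf0 gtn_eqF.
rewrite qE /c/= Pdiv.CommonRing.rmodp_small ?hE ?coefXn 1?eq_sym//.
by rewrite !size_polyXn !ltnS.
Qed.

(** * Enumeration of partitions *)

(* Strictly increasing lists of parts in [a, a + B), the reversals of partitions
   into distinct parts; [part_seqs B k a] is the analogue for weakly increasing
   lists of length k. *)
Fixpoint distinct_seqs B a : seq (seq nat) :=
  if B is B'.+1 then
    map (cons a) (distinct_seqs B' a.+1) ++ distinct_seqs B' a.+1
  else [:: [::]].

Fixpoint part_seqs B k a : seq (seq nat) :=
  if B is B'.+1 then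
    (fix inner k := if k is k'.+1 then
       map (cons a) (inner k') ++ part_seqs B' k'.+1 a.+1 else [:: [::]]) k
  else if k is 0 then [:: [::]] else [::].

Lemma part_seqsS B k a : part_seqs B.+1 k.+1 a =
  map (cons a) (part_seqs B.+1 k a) ++ part_seqs B k.+1 a.+1.
Proof. by []. Qed.

Lemma mem_map_cons (T : eqType) (a x : T) (s : seq T) (L : seq (seq T)) :
  (x :: s \in map (cons a) L) = (x == a) && (s \in L).
Proof.
apply/mapP/andP => [[t tL [-> ->]]|[/eqP -> sL]]; last by exists s.
by rewrite eqxx.
Qed.

Lemma nil_map_cons (T : eqType) (a : T) (L : seq (seq T)) :
  ([::] \in map (cons a) L) = false.
Proof. by apply/mapP => -[]. Qed.

Lemma mem_distinct_seqs B a s : (s \in distinct_seqs B a) =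
  sorted ltn s && all (fun i => a <= i < a + B)%N s.
Proof.
elim: B a s => [|B IH] a [|x s]; rewrite /= ?inE ?mem_cat ?nil_map_cons ?IH//=.
  by rewrite addn0 (_ : (a <= x < a)%N = false) ?andbF//; lia.
rewrite mem_map_cons !IH !(path_sortedE ltn_trans).
have [->|xa] := eqVneq x a.
  rewrite /= leqnn ltnn /= andbF orbF addnS ltnS leq_addr/= -addSn.
  case: (sorted _ s); rewrite /= ?andbF ?andbT//= -all_predI.
  by apply: eq_all => i /=; lia.
rewrite /= addSnnS.
case: (sorted _ s); rewrite /= ?andbF//.
have -> : (a <= x)%N = (a < x)%N by lia.
case: (boolP (all (ltn x) s)) => //= h.
case: (boolP (a < x)%N) => //= ax; case: (x < _)%N => //=.
apply: eq_in_all => i /(allP h)/=; lia.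
Qed.

Lemma mem_part_seqs B k a s : (s \in part_seqs B k a) =
  [&& sorted leq s, all (fun i => a <= i < a + B)%N s & size s == k].
Proof.
elim: B k a s => [|B IHB] k a s.
  case: k s => [|k] [|x s] //=; rewrite ?inE ?andbF//= addn0.
  by rewrite (_ : (a <= x < a)%N = false) ?andbF//; lia.
elim: k s => [|k IHk] [|x s] //; rewrite ?inE ?andbF//=.
  by rewrite mem_cat nil_map_cons IHB.
rewrite mem_cat mem_map_cons IHk IHB/= !(path_sortedE leq_trans) eqSS.
have [->|xa] := eqVneq x a.
  rewrite /= leqnn ltnn /= andbF orbF addnS ltnS leq_addr/=.
  case: (sorted _ s); rewrite /= ?andbF//.
  have [/= h|/allPn[i ins hi]] := boolP (all (fun i => a <= i < _)%N s).
    suff -> : all (leq a) s by [].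
    by apply/allP => i /(allP h) /andP[].
  by rewrite andbF.
rewrite /= addSnnS.
case: (sorted _ s); rewrite /= ?andbF//.
have -> : (a <= x)%N = (a < x)%N by lia.
case: (boolP (all (leq x) s)) => //= h.
case: (boolP (a < x)%N) => //= ax; case: (x < _)%N => //=.
congr (_ && _); apply: eq_in_all => i /(allP h)/=; lia.
Qed.

Lemma distinct_seqs_uniq B a : uniq (distinct_seqs B a).
Proof.
elim: B a => // B IH a /=; rewrite cat_uniq IH map_inj_uniq ?IH => [|x y []]//.
rewrite /= andbT; apply/hasPn => -[|x s]; first by rewrite nil_map_cons.
rewrite mem_distinct_seqs mem_map_cons/= => /andP[_ /andP[]].
by move=> /andP[ax _] _; apply/negP => /andP[/eqP xa _]; rewrite xa ltnn in ax.
Qed.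

Lemma part_seqs_uniq B k a : uniq (part_seqs B k a).
Proof.
elim: B k a => [[]//|B IHB] k a; elim: k => // k IHk.
rewrite part_seqsS cat_uniq IHB map_inj_uniq ?IHk => [|x y []]//.
rewrite /= andbT; apply/hasPn => -[|x s]; first by rewrite nil_map_cons.
rewrite mem_part_seqs mem_map_cons/= => /and3P[_ /andP[/andP[ax _] _] _].
by apply/negP => /andP[/eqP xa _]; rewrite xa ltnn in ax.
Qed.

Lemma sum_distinct_seqs (A : comNzRingType) (q : A) B a :
  \sum_(s <- distinct_seqs B a) (-1) ^+ size s * q ^+ sumn s =
  \prod_(a <= l < a + B) (1 - q ^+ l).
Proof.
elim: B a => [|B IH] a /=.
  by rewrite big_seq1 addn0 big_geq// mulr1.
rewrite big_cat big_map -addSnnS [RHS]big_ltn ?leq_addr// -!IH.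
rewrite mulrBl mul1r addrC mulr_sumr -sumrN; congr (_ + _).
by apply: eq_bigr => s _ /=; rewrite exprD exprS; ring.
Qed.

(** Either a is the first part, or all parts exceed a. The range stops at N because a larger part
    contributes 0; at a = N+1 both sides vanish unless k = 0. *)
Lemma sum_part_seqs (A : comNzRingType) (q : A) N B k a :
  q ^+ N.+1 = 0 -> (0 < a)%N -> (a + B = N.+1)%N ->
  \sum_(s <- part_seqs B k a) q ^+ sumn s = q ^+ (a * k) * iqfact q N k.
Proof.
move=> qN; elim: B k a => [|B IHB] k a a0 aB.
  case: k => [|k]; first by rewrite big_seq1 muln0 iqfact0 mulr1.
  rewrite big_nil -aB addn0 in qN *.
  by rewrite mulnS exprD qN !mul0r.
elim: k => [|k IHk]; first by rewrite big_seq1 muln0 iqfact0 mulr1.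
rewrite part_seqsS big_cat big_map IHB ?addSnnS//=.
under eq_bigr do rewrite exprD.
rewrite -mulr_sumr IHk -(iqfactS qN k) mulSn mulnS !exprD; ring.
Qed.

Lemma is_partition_rev s : is_partition (rev s) = sorted leq s && all (ltn 0) s.
Proof. by rewrite /is_partition rev_sorted all_rev. Qed.

Lemma is_distinct_partition_rev s :
  is_distinct_partition (rev s) = sorted ltn s && all (ltn 0) s.
Proof.
by rewrite /is_distinct_partition is_partition_rev rev_uniq ltn_sorted_uniq_leq
  andbC andbA.
Qed.

Lemma le_smallest_part n p : ((n%:Z)%:E <= smallest_part p)%E = all (leq n) p.
Proof.
rewrite /smallest_part; elim: p => [|x p IH]; first by rewrite big_nil leey.
by rewrite big_cons le_min IH lee_fin lez_nat.
Qed.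

Lemma smallest_part_rev s : smallest_part (rev s) = smallest_part s.
Proof. by apply: perm_big; rewrite perm_rev. Qed.

Lemma smallest_part_cons n p : all (leq n) p ->
  smallest_part (n :: p) = (n%:Z)%:E.
Proof. by rewrite -le_smallest_part /smallest_part big_cons => /min_l. Qed.

(** In reversed lists the smallest part of pi_1 is the head n, so the condition on smallest parts
    bounds the entries of the other two lists from below by n. *)
Lemma in_S_rev n t s2 s3 : path ltn n t ->
  in_S (rev (n :: t), rev s2, rev s3) =
  [&& (0 < n)%N, sorted leq s2, all (leq n) s2, sorted leq s3 & all (leq n) s3].
Proof.
move=> nt; have lent : all (leq n) t.
  by move: nt; rewrite path_sortedE; [move=> /andP[+ _]; apply: sub_all => i /ltnW|
    exact: ltn_trans].
rewrite /in_S is_distinct_partition_rev !is_partition_rev !smallest_part_rev.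
rewrite smallest_part_cons// le_min !le_smallest_part ltey_eq/= nt/= andbT.
rewrite lee_fin lez_nat.
have [n0|_]/= := boolP (0 < n)%N; last by [].
have -> : all (ltn 0) t by apply: sub_all lent => i; exact: leq_trans.
have h s : all (leq n) s -> all (ltn 0) s by apply: sub_all => i; exact: leq_trans.
case: (sorted _ s2) => //=; case: (sorted _ s3) => //=; last by rewrite !andbF.
have [/h ->|]/= := boolP (all (leq n) s2); last by rewrite !andbF.
by have [/h ->|]/= := boolP (all (leq n) s3); rewrite ?andbF.
Qed.

Lemma sum_distinct_seqs_head (V : nmodType) (F : seq nat -> V) B a :
  \sum_(s <- distinct_seqs B a | s != [::]) F s =
  \sum_(a <= n < a + B) \sum_(t <- distinct_seqs (a + B - n.+1) n.+1) F (n :: t).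
Proof.
elim: B a => [|B IH] a /=; first by rewrite big_cons big_nil addn0 big_geq.
rewrite big_cat big_map IH/= [RHS]big_ltn -?addSnnS ?leq_addr//.
by rewrite addKn.
Qed.

(** A single index set for all lengths and lower bounds, so that sums over it can be exchanged;
    [sum_bounded_parts] cuts out one length and one bound. *)
Definition bounded_parts N K : seq (seq nat) :=
  undup (flatten [seq part_seqs N k 1 | k <- iota 0 K]).

Lemma mem_bounded_parts N K s : (s \in bounded_parts N K) =
  [&& sorted leq s, all (fun i => 0 < i <= N)%N s & (size s < K)%N].
Proof.
rewrite mem_undup; apply/flatten_mapP/and3P => [[k]|[h1 h2 h3]].
  by rewrite mem_iota mem_part_seqs => kK /and3P[-> -> /eqP ->].
by exists (size s); rewrite ?mem_iota ?mem_part_seqs ?h1 ?h2/=.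
Qed.

Lemma sum_bounded_parts (V : nmodType) (F : seq nat -> V) N K k n :
  (0 < n <= N)%N -> (k < K)%N ->
  \sum_(s <- bounded_parts N K | all (leq n) s && (size s == k)) F s =
  \sum_(s <- part_seqs (N.+1 - n) k n) F s.
Proof.
move=> /andP[n0 nN] kK; rewrite -big_filter; apply: perm_big; apply: uniq_perm.
- by rewrite filter_uniq// undup_uniq.
- exact: part_seqs_uniq.
move=> s; rewrite mem_filter mem_bounded_parts mem_part_seqs.
have [|] := eqVneq (size s) k; last by rewrite !andbF.
move=> ->; rewrite kK !andbT andbC -andbA; congr (_ && _).
rewrite -all_predI; apply: eq_all => i /=; lia.
Qed.

Lemma sumn_ge_mem (s : seq nat) i : i \in s -> (i <= sumn s)%N.
Proof.
elim: s => //= x s IH; rewrite inE => /orP[/eqP ->|/IH h]; first exact: leq_addr.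
by rewrite (leq_trans h)// leq_addl.
Qed.

(** A finite list containing [S_of m N]: pi_3 has at most N parts, and crank m then leaves at most m
    + N parts for pi_2. *)
Definition vpart_seq N m : seq vpart :=
  [seq (u, rev s) | u <- [seq (rev s1, rev s2) | s1 <- distinct_seqs N 1,
                                         s2 <- bounded_parts N (m + N).+1],
                    s <- bounded_parts N N.+1].

Lemma vpart_seq_uniq N m : uniq (vpart_seq N m).
Proof.
rewrite allpairs_uniq//; first rewrite allpairs_uniq// ?undup_uniq//.
- exact: distinct_seqs_uniq.
- by move=> [? ?] [? ?] _ _ [/(inv_inj revK) -> /(inv_inj revK) ->].
- exact: undup_uniq.
- by move=> [? ?] [? ?] _ _ /= [-> /(inv_inj revK) ->].
Qed.

Lemma S_of_sub_vpart_seq N m v : S_of m%:Z N v -> v \in vpart_seq N m.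
Proof.
move: v => [[p1 p2] p3] [/= hS hw hc].
rewrite -(revK p1) -(revK p2) -(revK p3) in hS hw hc *.
set s1 := rev p1 in hS hw hc *; set s2 := rev p2 in hS hw hc *.
set s3 := rev p3 in hS hw hc *.
clearbody s1 s2 s3; have /and5P[] := hS.
rewrite is_distinct_partition_rev !is_partition_rev.
move=> /andP[h1 h1'] /andP[h2 h2'] /andP[h3 h3'] _ _.
rewrite !sumn_rev in hw; rewrite !size_rev in hc.
have hall s : all (ltn 0) s -> (sumn s <= N)%N -> all (fun i => 0 < i <= N)%N s.
  move=> /allP s0 sN; apply/allP => i si; have /= -> := s0 _ si.
  by rewrite (leq_trans _ sN)//; exact: sumn_ge_mem.
have hsz : (size s3 <= N)%N.
  have : (size (rev s3) <= sumn (rev s3))%N.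
    by apply: partition_size_sumn; rewrite is_partition_rev h3.
  by rewrite size_rev sumn_rev; clear -hw; lia.
apply: (allpairs_f (fun u s => (u, rev s))); 
  first apply: (allpairs_f (fun s1 s2 => (rev s1, rev s2))).
- by rewrite mem_distinct_seqs h1; apply: hall => //; clear -hw; lia.
- by rewrite mem_bounded_parts h2 hall//=; clear -hw hc hsz; lia.
- by rewrite mem_bounded_parts h3 hall//=; clear -hw hc hsz; lia.
Qed.

(** Here n is the smallest part of pi_1 and t lists the others, whence the sign (-1)^(size t); j
    counts the parts of pi_3, and the crank forces m + j parts in pi_2. *)
Lemma N_S_sum N m : N_S m%:Z N =
  \sum_(1 <= n < N.+1) \sum_(t <- distinct_seqs (N - n) n.+1)
    \sum_(j < N.+1) \sum_(s2 <- part_seqs (N.+1 - n) (m + j) n)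
      \sum_(s3 <- part_seqs (N.+1 - n) j n)
         (-1) ^+ size t * (n + sumn t + sumn s2 + sumn s3 == N)%N%:R.
Proof.
rewrite /N_S.
pose r := [seq v <- vpart_seq N m | v \in S_of m%:Z N].
rewrite (fsbigE r); last 3 first.
- by rewrite filter_uniq// vpart_seq_uniq.
- by move=> v /=; rewrite mem_filter => /andP[+ _]; rewrite inE.
- move=> v Sv; rewrite mem_filter mem_set//= => /negP[].
  exact: S_of_sub_vpart_seq.
rewrite big_filter_cond.
under eq_bigl do rewrite andbb.
rewrite big_mkcond /vpart_seq !big_allpairs_dep/=.
pose G s1 := \sum_(s2 <- bounded_parts N (m + N).+1)
  \sum_(s3 <- bounded_parts N N.+1)
    if (rev s1, rev s2, rev s3) \in S_of m%:Z N
    then omega1 (rev s1, rev s2, rev s3) else 0.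
rewrite -/G.
(* The empty pi_1 has smallest part +oo and lies outside S. *)
transitivity (\sum_(s1 <- distinct_seqs N 1 | s1 != [::]) G s1).
  rewrite [RHS]big_mkcond; apply: eq_bigr => -[|//] _ /=.
  rewrite /G big1// => s2 _; rewrite big1// => s3 _.
  rewrite ifF//; apply/negbTE/negP; rewrite inE => -[/=].
  by rewrite /smallest_part big_nil ltxx !andbF.
rewrite sum_distinct_seqs_head; apply: eq_big_nat => n /andP[n0 nN].
have {}nN : (n <= N)%N by [].
rewrite subSS; apply: eq_big_seq => t; rewrite mem_distinct_seqs => /andP[st at_].
have nt : path ltn n t.
  rewrite path_sortedE; last exact: ltn_trans.
  by rewrite st andbT; apply: sub_all at_ => i /andP[].
under [RHS]eq_bigr => j _.
  rewrite -(@sum_bounded_parts _ _ N (m + N).+1); last 2 first.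
    by rewrite n0.
    by rewrite ltnS leq_add2l -ltnS.
  rewrite big_mkcond.
  under eq_bigr do rewrite -(@sum_bounded_parts _ _ N N.+1) ?n0//.
  over.
rewrite exchange_big/=; apply: eq_big_seq => s2; rewrite mem_bounded_parts.
move=> /and3P[ss2 _ _].
(* The conditions on lengths become an indicator, so that for fixed s2 and s3 only the index
   [size s3] can contribute. *)
transitivity (\sum_(i < N.+1) \sum_(s3 <- bounded_parts N N.+1)
    if [&& all (leq n) s2, size s2 == (m + i)%N, all (leq n) s3 & size s3 == i]
    then (-1) ^+ size t * (n + sumn t + sumn s2 + sumn s3 == N)%N%:R else 0 : int);
    last first.
  apply: eq_bigr => i _; rewrite [in RHS]big_mkcond/=.
  case: (all _ s2) => /=; last by rewrite big1.
  by case: (_ == _) => //=; rewrite big1.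
rewrite exchange_big/=; apply: eq_big_seq => s3; rewrite mem_bounded_parts.
move=> /and3P[ss3 _ ls3]; rewrite (bigD1 (Ordinal ls3))//= big1 ?addr0; last first.
  move=> i; rewrite -val_eqE/= eq_sym => /negbTE ->.
  by rewrite !andbF.
rewrite eqxx andbT.
have -> : ((rev (n :: t), rev s2, rev s3) \in S_of m%:Z N) =
    ([&& all (leq n) s2, size s2 == (m + size s3)%N & all (leq n) s3] &&
     (n + sumn t + sumn s2 + sumn s3 == N)%N).
  apply/idP/idP; rewrite inE.
    move=> -[]; rewrite in_S_rev// => /and5P[_ _ -> _ ->].
    rewrite /vweight /crank !sumn_rev !size_rev/= => -> hc.
    by rewrite eqxx !andbT; lia.
  move=> /andP[/and3P[h2 /eqP h h3] /eqP hN].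
  split; first by rewrite in_S_rev// n0 ss2 ss3 h2 h3.
    by rewrite /vweight !sumn_rev.
  by rewrite /crank !size_rev h PoszD addrK.
case: (_ == N); rewrite ?andbT ?andbF ?mulr1 ?mulr0 ?if_same//.
by rewrite /omega1 size_rev.
Qed.

Lemma N_S_coef (A : comNzRingType) (q : A) (coef : {additive A -> int}) N m :
  q ^+ N.+1 = 0 -> (forall w, coef (q ^+ w) = (w == N)%:R) ->
  N_S m%:Z N = coef (\sum_(1 <= n < N.+1) gterm q N m n).
Proof.
move=> qN hc; rewrite N_S_sum raddf_sum; apply: eq_big_nat => n /andP[n0 nN].
have {}nN : (n <= N)%N by [].
(* As q^(n(m+j)) q^(nj) = q^(nm) q^(2nj), the two partition sums combine into H_m at q^(2n). *)
have -> : gterm q N m n = q ^+ n * \prod_(n.+1 <= l < n.+1 + (N - n)) (1 - q ^+ l) *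
   \sum_(j < N.+1) (q ^+ (n * (m + j)) * iqfact q N (m + j)) *
                   (q ^+ (n * j) * iqfact q N j).
  rewrite /gterm addSn subnKC//; congr (_ * _); rewrite /hsum mulr_sumr.
  by apply: eq_bigr => j _; rewrite -muln2 mulnDr -mulnA mul2n -addnn mulnDr !exprD; ring.
rewrite -sum_distinct_seqs [q ^+ n * _]mulr_sumr mulr_suml raddf_sum; apply: eq_bigr => t _.
rewrite mulr_sumr raddf_sum; apply: eq_bigr => j _.
rewrite -!(@sum_part_seqs _ _ _ (N.+1 - n))//; try lia.
rewrite mulr_suml mulr_sumr raddf_sum; apply: eq_bigr => s2 _.
rewrite !mulr_sumr raddf_sum; apply: eq_bigr => s3 _.
(* The sign is an integer on one side and an element of A on the other; reduced to a parity, it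
   passes through the additive map [coef]. *)
rewrite -!mulrA mulrCA -signr_odd -[in RHS]signr_odd; set e := odd _.
rewrite -hc !exprD -!mulrA.
by case: e; rewrite ?expr0 ?expr1 ?mulN1r ?mul1r ?raddfN.
Qed.

Lemma N_S_gt0 N m : (0 < m < N)%N -> (2 * N <= m.+1 ^ 2)%N ->
  0 < N_S m%:Z N.
Proof.
move=> hmN hm; have [A [q [coef [qN hc]]]] := truncated_series_exists N.
by rewrite (N_S_coef _ qN hc) coef_sum_gterm_gt0.
Qed.

(** * Subexponential growth *)

Section UpperBound.
Variables (R : realType) (x : R).
Hypotheses (x0 : 0 < x) (x1 : x < 1).

(** The generating function, at a real point, of all partitions with parts in [a, a + B); it
    majorizes the sums over fixed length and over distinct parts. *)
Definition recip_qpoch B a : R := \prod_(a <= l < a + B) (1 - x ^+ l)^-1.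

Lemma exprn_lt1 l : (0 < l)%N -> x ^+ l < 1.
Proof. by move=> l0; rewrite exprn_ilt1 ?ltW// -lt0n. Qed.

Lemma recip_qpoch_ge1 B a : (0 < a)%N -> 1 <= recip_qpoch B a.
Proof.
move=> a0; rewrite /recip_qpoch big_nat; elim/big_ind: _ => //.
  by move=> u v u1 v1; rewrite -[1]mulr1 ler_pM.
move=> l /andP[al _]; have xl : x ^+ l < 1 by apply: exprn_lt1; exact: leq_trans al.
by rewrite invf_ge1 ?subr_gt0// gerBl exprn_ge0// ltW.
Qed.

Lemma recip_qpochS B a :
  recip_qpoch B.+1 a = (1 - x ^+ a)^-1 * recip_qpoch B a.+1.
Proof. by rewrite /recip_qpoch big_ltn -?addSnnS ?leq_addr. Qed.

Lemma sum_part_seqs_le B k a : (0 < a)%N ->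
  \sum_(s <- part_seqs B k a) x ^+ sumn s <= recip_qpoch B a.
Proof.
elim: B k a => [|B IHB] k a a0.
  case: k => [|k]; first by rewrite big_seq1 recip_qpoch_ge1.
  by rewrite big_nil (le_trans _ (recip_qpoch_ge1 _ _)).
elim: k => [|k IHk]; first by rewrite big_seq1 recip_qpoch_ge1.
rewrite part_seqsS big_cat big_map/=; under eq_bigr do rewrite exprD.
rewrite -mulr_sumr.
have xa := exprn_lt1 a0.
apply: (@le_trans _ _ (x ^+ a * recip_qpoch B.+1 a + recip_qpoch B a.+1)).
  by rewrite lerD ?IHB// ler_wpM2l// exprn_ge0// ltW.
by rewrite recip_qpochS; set Q := recip_qpoch _ _; rewrite le_eqVlt; apply/orP; left;
  apply/eqP; field; lra.
Qed.

Lemma sum_distinct_seqs_le B a : (0 < a)%N ->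
  \sum_(s <- distinct_seqs B a) x ^+ sumn s <= recip_qpoch B a.
Proof.
elim: B a => [|B IH] a a0 /=; first by rewrite big_seq1 recip_qpoch_ge1.
rewrite big_cat big_map/=; under eq_bigr do rewrite exprD.
rewrite -mulr_sumr recip_qpochS -[X in _ + X]mul1r -mulrDl.
have xa := exprn_lt1 a0; have xa0 : 0 < x ^+ a by rewrite exprn_gt0.
rewrite ler_pM ?IH//; first by rewrite addr_ge0 ?ltW.
  by rewrite sumr_ge0// => s _; rewrite exprn_ge0// ltW.
by rewrite -[leRHS]mul1r ler_pdivlMr ?subr_gt0//; nra.
Qed.

(** Each factor is 1 + x^l / (1 - x^l) <= exp (x^l / (1 - x)), and the x^l sum to at most 1 / (1 -
    x). *)
Lemma recip_qpoch_le B a : (0 < a)%N ->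
  recip_qpoch B a <= expR ((1 - x)^-1 ^+ 2).
Proof.
move=> a0; have x1' : 0 < 1 - x by rewrite subr_gt0.
apply: (@le_trans _ _ (expR ((1 - x)^-1 * \sum_(a <= l < a + B) x ^+ l))).
  rewrite mulr_sumr expR_sum; rewrite /recip_qpoch !big_nat.
  apply: ler_prod => l /andP[al _].
  have l0 : (0 < l)%N by exact: leq_trans al.
  have xl := exprn_lt1 l0; rewrite invr_ge0 subr_ge0 (ltW xl)/=.
  apply: le_trans (expR_ge1Dx _).
  have xx : x ^+ l <= x by rewrite -[leRHS]expr1 ler_wiXn2l// ltW.
  have xl0 : 0 < x ^+ l by rewrite exprn_gt0.
  rewrite -lerBlDl [leLHS](_ : _ = (1 - x ^+ l)^-1 * x ^+ l); last by field; lra.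
  apply: ler_wpM2r; first exact: ltW.
  by rewrite lef_pV2 ?posrE; lra.
rewrite ler_expR expr2; apply: ler_wpM2l; first by rewrite invr_ge0 ltW.
rewrite -[leRHS]mul1r ler_pdivlMr//.
apply: (@le_trans _ _ ((\sum_(l < a + B) x ^+ l) * (1 - x))).
  apply: ler_wpM2r; first exact: ltW.
  rewrite -(big_mkord xpredT (fun l => x ^+ l)).
  rewrite [leRHS](@big_cat_nat _ _ _ a)//= ?leq_addr// lerDr sumr_ge0// => i _.
  by rewrite exprn_ge0// ltW.
by rewrite mulrC -opprB mulNr -subrX1 opprB gerBl exprn_ge0// ltW.
Qed.

Lemma sum_le_mul (T : Type) (r : seq T) (F G : T -> R) (e k : R) :
  0 <= k -> \sum_(s <- r) F s <= e -> (forall s, G s <= k * F s) ->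
  \sum_(s <- r) G s <= k * e.
Proof.
move=> k0 Fe GF; apply: (le_trans (ler_sum _ (fun s _ => GF s))).
by rewrite -mulr_sumr ler_wpM2l.
Qed.

(** Signs are dropped, and the weight condition is traded for the factor x^(-N): a triple of weight
    N satisfies x^(-N) x^(|t| + |s2| + |s3|) >= 1. Each of the three partition sums is then at most
    E, and the choices of n and j give (N+1)^2. *)
Lemma N_S_le m N :
  `|(N_S m%:Z N)%:~R| <=
  x^-1 ^+ N * expR ((1 - x)^-1 ^+ 2) ^+ 3 * N.+1%:R ^+ 2.
Proof.
set E := expR _; set w := x^-1 ^+ N.
have E0 : 0 <= E by exact: expR_ge0.
have w0 : 0 <= w by rewrite exprn_ge0// invr_ge0 ltW.
have xn0 n : 0 <= x ^+ n by rewrite exprn_ge0// ltW.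
rewrite N_S_sum !rmorph_sum/= (le_trans (ler_norm_sum _ _ _))//.
rewrite big_add1/= big_mkord [leRHS](_ : _ = w * E ^+ 2 * N.+1%:R * E * N.+1%:R);
  last by ring.
apply: (@le_trans _ _ (\sum_(n < N) w * E ^+ 2 * N.+1%:R * E)); last first.
  rewrite sumr_const card_ord -[leLHS]mulr_natr; apply: ler_wpM2l.
    by rewrite !mulr_ge0// exprn_ge0.
  by rewrite ler_nat.
apply: ler_sum => n _; rewrite rmorph_sum (le_trans (ler_norm_sum _ _ _))//=.
apply: (@sum_le_mul _ _ (fun t => x ^+ sumn t)) => [||t].
- by rewrite !mulr_ge0// exprn_ge0.
- by rewrite (le_trans (sum_distinct_seqs_le _ _))// recip_qpoch_le.
rewrite rmorph_sum (le_trans (ler_norm_sum _ _ _))//=.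
apply: (@le_trans _ _ (\sum_(j < N.+1) w * E ^+ 2 * x ^+ sumn t)); last first.
  by rewrite sumr_const card_ord -[leLHS]mulr_natr mulrAC.
apply: ler_sum => j _; rewrite rmorph_sum (le_trans (ler_norm_sum _ _ _))//=.
rewrite [leRHS](_ : _ = w * x ^+ sumn t * E * E); last by ring.
have hE k : \sum_(s <- part_seqs (N.+1 - n.+1) k n.+1) x ^+ sumn s <= E.
  by rewrite (le_trans (sum_part_seqs_le _ _ _))// recip_qpoch_le.
apply: sum_le_mul (hE (m + j)%N) _ => [|s2]; first by rewrite !mulr_ge0.
rewrite mulrAC rmorph_sum (le_trans (ler_norm_sum _ _ _))//=.
apply: sum_le_mul (hE j) _ => [|s3]; first by rewrite !mulr_ge0.
rewrite -signr_odd rmorphM/= normrM; set e := odd _.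
have -> : `|((-1) ^+ e)%:~R| = 1 :> R by case: e; rewrite ?normrN1 ?normr1.
rewrite mul1r; case: eqP => [hN|_]; last by rewrite normr0 !mulr_ge0.
rewrite normr1 -!mulrA -!exprD /w -{}hN exprVn mulrC ler_pdivlMr ?exprn_gt0//.
by rewrite mul1r ler_wiXn2l// ?ltW//; lia.
Qed.
End UpperBound.

Lemma poly_le_exp (R : realType) (C e : R) : 0 < e -> 
  \forall n \near \oo, C * n.+1%:R ^+ 3 <= expR (e * n%:R).
Proof.
(* This c gives c (n+1) <= 1 + e n / 4 <= exp (e n / 4), whose fourth power outgrows the cube. *)
move=> e0; pose c := Num.min (e / 4) 1.
have c0 : 0 < c by rewrite lt_min ltr01 divr_gt0.
have c1 : c <= 1 by rewrite ge_min lexx orbT.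
have ce : c <= e / 4 by rewrite ge_min lexx.
near=> n.
have hn : C / c ^+ 4 <= n.+1%:R.
  near: n; exists (Num.bound `|C / c ^+ 4|) => // n /= hn.
  rewrite (le_trans (ler_norm _))// ltW// (lt_le_trans (archi_boundP _))//.
  by rewrite ler_nat leqW.
apply: (@le_trans _ _ ((c * n.+1%:R) ^+ 4)).
  rewrite exprMn [leRHS](_ : _ = c ^+ 4 * n.+1%:R * n.+1%:R ^+ 3);
    last by rewrite -mulrA -exprS.
  apply: ler_wpM2r; first exact: exprn_ge0.
  by rewrite mulrC -ler_pdivrMr ?exprn_gt0.
have -> : e * n%:R = (e / 4 * n%:R) * 4%:R by field.
rewrite expRM_natr; apply: lerXn2r; rewrite ?nnegrE ?expR_ge0//.
  by rewrite mulr_ge0// ltW.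
rewrite (le_trans _ (expR_ge1Dx _))// -natr1 mulrDr mulr1 addrC lerD//.
by rewrite ler_wpM2r.
Unshelve. all: by end_near. Qed.

Lemma N_S_subexp (R : realType) (e : R) : 0 < e ->
  \forall N \near \oo, \sum_(m < N) `|(N_S m%:Z N)%:~R| <= expR (e * N%:R) :> R.
Proof.
(* With this x, x^(-N) = exp (e N / 2) uses half of the exponent; the other half absorbs the
   polynomial factor. *)
move=> e0; pose x := expR (- (e / 2)).
have x0 : 0 < x by exact: expR_gt0.
have x1 : x < 1 by rewrite expR_lt1 oppr_lt0 divr_gt0.
have e20 : 0 < e / 2 by rewrite divr_gt0.
have := poly_le_exp (expR ((1 - x)^-1 ^+ 2) ^+ 3) e20.
apply: filterS => N hN.
apply: (@le_trans _ _ (x^-1 ^+ N * (expR ((1 - x)^-1 ^+ 2) ^+ 3 * N.+1%:R ^+ 3))).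
  apply: (le_trans (ler_sum _ (fun (m : 'I_N) _ => N_S_le x0 x1 m N))).
  rewrite sumr_const card_ord -[leLHS]mulr_natr -!mulrA [N.+1%:R ^+ 3]exprSr.
  rewrite !ler_wpM2l ?exprn_ge0 ?invr_ge0 ?expR_ge0//.
  by rewrite expr2 -mulrA !ler_wpM2l// ler_nat.
have -> : x^-1 ^+ N = expR (e / 2 * N%:R) by rewrite -expRN opprK expRM_natr.
have -> : e * N%:R = e / 2 * N%:R + e / 2 * N%:R by field.
by rewrite expRD ler_wpM2l ?expR_ge0.
Qed.

(** * The complex modulus *)

Section ComplexModulus.
Variable R : realType.
Implicit Types (x y z : R[i]).

(** The norm takes values in R[i]; [normc] is its real-valued version, in which the estimates are
    made. *)
Lemma normrE_normc z : `|z| = real_complex R (normc z).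
Proof. by rewrite normc_def; case: z. Qed.

Lemma normc_ge0 z : 0 <= normc z.
Proof. by rewrite -ler0c -normrE_normc normr_ge0. Qed.

Lemma normc_gt0 z : z != 0 -> 0 < normc z.
Proof.
by move=> z0; rewrite lt_def normc_ge0 andbT; apply: contra_neq z0; exact: eq0_normc.
Qed.

Lemma normcX z n : normc (z ^+ n) = normc z ^+ n.
Proof. by elim: n => [|n IH]; rewrite ?expr0 ?normc1// !exprS normcM IH. Qed.

Lemma normc_prod (I : Type) (r : seq I) (P : pred I) (F : I -> R[i]) :
  normc (\prod_(i <- r | P i) F i) = \prod_(i <- r | P i) normc (F i).
Proof. by apply: big_morph; [exact: normcM|exact: normc1]. Qed.

Lemma normc_sum (I : Type) (r : seq I) (P : pred I) (F : I -> R[i]) :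
  normc (\sum_(i <- r | P i) F i) <= \sum_(i <- r | P i) normc (F i).
Proof.
elim/big_ind2: _ => [|x1 x2 y1 y2 h1 h2|//]; first by rewrite normc0.
by rewrite (le_trans (le_normcD _ _))// lerD.
Qed.

Lemma normc_conj z : normc z^* = normc z.
Proof. by apply: (@complexI R); rewrite -!normrE_normc norm_conjC. Qed.

Lemma normc_real (a : R) : normc (real_complex R a) = `|a|.
Proof. by rewrite /= expr0n addr0 sqrtr_sqr. Qed.

Lemma normc_nat n : normc (n%:R : R[i]) = n%:R.
Proof. by rewrite -(rmorph_nat (real_complex R)) normc_real normr_nat. Qed.

Lemma distcC x y : normc (x - y) = normc (y - x).
Proof. by rewrite -normcN opprB. Qed.

Lemma normc_sqr z : normc z ^+ 2 = complex.Re z ^+ 2 + complex.Im z ^+ 2.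
Proof. by case: z => a b /=; rewrite sqr_sqrtr// addr_ge0 ?sqr_ge0. Qed.

Lemma normc_sqrC z : real_complex R (normc z ^+ 2) = z * z^*.
Proof. by rewrite rmorphXn/= -normrE_normc normCK. Qed.

Lemma normc_geRe z : `|complex.Re z| <= normc z.
Proof.
rewrite -(ler_pXn2r (n := 2)) ?nnegrE ?normc_ge0//.
by rewrite normc_sqr -normrX ger0_norm ?sqr_ge0// lerDl sqr_ge0.
Qed.

Lemma norm_inv_conj z : normc z = 1 -> z^-1 = z^*.
Proof.
move=> z1; have z0 : z != 0 by apply/eqP => z0; move: z1; rewrite z0 normc0; lra.
by apply: (mulfI z0); rewrite mulfV// -normc_sqrC z1 expr1n.
Qed.

(** Since exp (3t^2 - t) >= 1 - t + 3t^2 and (1 + t)(1 - t + 3t^2) = 1 + t^2 (2 + 3t) >= 1. *)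
Lemma expR_le_1D (t : R) : - (2 / 3) <= t -> expR (t - 3 * t ^+ 2) <= 1 + t.
Proof.
move=> ht; rewrite -(opprK (t - _)) expRN invf_ple ?posrE ?expR_gt0//; last lra.
apply: le_trans (expR_ge1Dx _); rewrite -[leLHS]mul1r ler_pdivrMr; last lra.
by nra.
Qed.

Lemma normc_1B_ge y : normc y <= 4^-1 ->
  expR (- complex.Re y - 8 * normc y ^+ 2) <= normc (1 - y).
Proof.
move=> hy; rewrite -(ler_pXn2r (n := 2)) ?nnegrE ?expR_ge0 ?normc_ge0//.
rewrite -expRM_natr; set a := complex.Re y; set m := normc y in hy *.
have m0 : 0 <= m := normc_ge0 y.
pose t := m ^+ 2 - 2 * a.
have -> : normc (1 - y) ^+ 2 = 1 + t.
  rewrite normc_sqr /t /m /a normc_sqr; case: (y) => u v /=; ring.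
have am : `|a| <= m := normc_geRe y.
have [a1 a2] : - m <= a /\ a <= m by move: am; rewrite ler_norml => /andP.
have t1 : - (2 / 3) <= t by rewrite /t; nra.
apply: le_trans (expR_le_1D t1); rewrite ler_expR.
(* The goal amounts to 3 t^2 <= 17 m^2, and |t| <= (9/4) m holds for m <= 1/4. *)
suff : t ^+ 2 <= (81 / 16) * m ^+ 2.
  have tE : t = m ^+ 2 - 2 * a by [].
  by have := sqr_ge0 m; move: (t ^+ 2) (m ^+ 2) tE => t2 m2; lra.
have : `|t| <= (2 + 4^-1) * m by rewrite ler_norml /t; apply/andP; split; nra.
move=> h; rewrite -(ger0_norm (sqr_ge0 t)) normrX.
apply: (@le_trans _ _ (((2 + 4^-1) * m) ^+ 2)); first by rewrite lerXn2r ?nnegrE//; lra.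
by rewrite exprMn; nra.
Qed.

End ComplexModulus.

(** * Roots of unity and roots reflected into the disc *)

Section RootsOfUnity.
Variable R : realType.

Definition cis (t : R) : R[i] := Complex (cos t) (sin t).

Lemma normc_cis t : normc (cis t) = 1.
Proof. by rewrite /= cos2Dsin2 sqrtr1. Qed.

Lemma cisD s t : cis (s + t) = cis s * cis t.
Proof. by rewrite /cis sinD cosD; simpc; congr (Complex _ _); ring. Qed.

Lemma cis0 : cis 0 = 1.
Proof. by rewrite /cis cos0 sin0. Qed.

Lemma cis_natmul t n : cis (t *+ n) = cis t ^+ n.
Proof. by elim: n => [|n IH]; rewrite ?mulr0n ?cis0// mulrS cisD IH exprS. Qed.

Lemma cis_neq1 t : 0 < t < 2 * pi -> cis t != 1.
Proof.
move=> /andP[t0 t2]; apply/eqP => -[ct _].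
have : 0 < sin (t / 2) by rewrite sin_gt0_pi//; lra.
have : cos t = cos (t / 2) ^+ 2 *+ 2 - 1.
  by rewrite -cos_mulr2n mulr2n -splitr.
have := cos2Dsin2 (t / 2).
rewrite ct; nra.
Qed.

Definition zeta (M : nat) : R[i] := cis (2 * pi / M%:R).

Lemma zetaX M j : zeta M ^+ j = cis (2 * pi * j%:R / M%:R).
Proof. by rewrite /zeta -cis_natmul -[_ *+ j]mulr_natr mulrAC. Qed.

Lemma zeta_prim M : (0 < M)%N -> M.-primitive_root (zeta M).
Proof.
move=> M0; have M0' : (M%:R : R) != 0 by rewrite pnatr_eq0 -lt0n.
have M0r : 0 < (M%:R : R) by rewrite ltr0n.
rewrite /primitive_root_of_unity M0; apply/forallP => i; rewrite unity_rootE zetaX.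
have [->|iM] := eqVneq i.+1 M.
  by rewrite mulfK// /cis mulr_natl cos2pi sin2pi eqxx.
rewrite eqbF_neg; apply: cis_neq1; rewrite divr_gt0 ?mulr_gt0 ?pi_gt0//=.
rewrite ltr_pdivrMr// ltr_pM2l ?mulr_gt0 ?pi_gt0// ltr_nat.
by rewrite ltn_neqAle iM ltn_ord.
Qed.

Lemma normc_zeta M j : normc (zeta M ^+ j) = 1.
Proof. by rewrite zetaX normc_cis. Qed.

Lemma sum_zetaX_neq M i l : (i < M)%N -> (l < M)%N -> i != l ->
  \sum_(j < M) (zeta M ^+ j) ^+ l / (zeta M ^+ j) ^+ i = 0.
Proof.
move=> iM lM il; have M0 : (0 < M)%N by exact: leq_trans iM.
have z0 : zeta M != 0.
  by apply/eqP => /(congr1 (@normc R)); rewrite normc_cis normc0; lra.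
pose y := zeta M ^+ l / zeta M ^+ i.
have y1 : y != 1.
  apply: contra_neq il => /divr1_eq /eqP.
  by rewrite (eq_prim_root_expr (zeta_prim M0)) !modn_small// => /eqP.
have : (y - 1) * \sum_(j < M) y ^+ j = 0.
  rewrite -subrX1 /y expr_div_n -!exprM ![(_ * M)%N]mulnC !exprM.
  by rewrite (prim_expr_order (zeta_prim M0)) !expr1n divr1 subrr.
move/eqP; rewrite mulf_eq0 subr_eq0 (negPf y1)/= => /eqP h; rewrite -[RHS]h.
by apply: eq_bigr => j _; rewrite /y expr_div_n -!exprM ![(j * _)%N]mulnC.
Qed.

(** Cauchy's estimate without integrals: averaging p(x) / x^i over the M-th roots of unity, with M >
    i and M >= size p, isolates the coefficient exactly. *)
Lemma coef_le_circle (p : {poly R[i]}) (B : R) i :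
  (forall x, normc x = 1 -> normc p.[x] <= B) -> normc p`_i <= B.
Proof.
move=> hB; pose M := maxn i.+1 (size p).
have iM : (i < M)%N by rewrite leq_maxl.
have M0 : (0 < M)%N by exact: leq_trans iM.
have zn0 j : zeta M ^+ j != 0.
  by apply/eqP => /(congr1 (@normc R)); rewrite normc_zeta normc0; lra.
have e : \sum_(j < M) p.[zeta M ^+ j] / (zeta M ^+ j) ^+ i = p`_i *+ M.
  under eq_bigr => j _.
    rewrite (@horner_coef_wide _ M) ?leq_maxr// mulr_suml.
    under eq_bigr do rewrite -mulrA. over.
  rewrite exchange_big/= (bigD1 (Ordinal iM))//= [X in _ + X]big1 ?addr0 => [|l li].
    rewrite (eq_bigr (fun=> p`_i)) ?sumr_const ?card_ord// => j _.
    by rewrite mulfV ?mulr1//; apply: expf_neq0; exact: zn0.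
  by rewrite -mulr_sumr sum_zetaX_neq ?mulr0// eq_sym.
have : normc (p`_i *+ M) <= B *+ M.
  rewrite -e (le_trans (normc_sum _ _ _))//.
  rewrite -[in leRHS](card_ord M) -sumr_const ler_sum// => j _.
  rewrite normcM normcV normcX normc_zeta expr1n invr1 mulr1.
  exact/hB/normc_zeta.
by rewrite normcMn lerMn2r eqn0Ngt M0.
Qed.

Lemma prod_1B_zeta k (a : R[i]) : (0 < k)%N ->
  \prod_(i < k) (1 - a * zeta k ^+ i) = 1 - a ^+ k.
Proof.
move=> k0; have [->|a0] := eqVneq a 0.
  rewrite expr0n gtn_eqF// subr0 big1// => i _; by rewrite mul0r subr0.
have := congr1 (fun p => p.[a^-1]) (factor_Xn_sub_1 (zeta_prim k0)).
rewrite horner_prod hornerD hornerN hornerXn hornerC big_mkord.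
move=> h; have -> : 1 - a ^+ k = a ^+ k * (a^-1 ^+ k - 1).
  by rewrite mulrBr exprVn mulfV ?expf_neq0// mulr1.
rewrite -h -[X in a ^+ X]card_ord -prodr_const -big_split/=.
by apply: eq_bigr => i _; rewrite hornerXsubC mulrBr mulfV.
Qed.

End RootsOfUnity.

Section IntoDisc.
Variable R : realType.
Implicit Types (z x : R[i]) (rs : seq R[i]).

(* The conjugate of the root, or of its reflection in the unit circle,
   whichever lies in the closed disc. *)
Definition into_disc z : R[i] := if normc z <= 1 then z^* else z^-1.

Lemma into_disc_le1 z : normc (into_disc z) <= 1.
Proof.
rewrite /into_disc; case: (lerP (normc z) 1) => [h|h]; first by rewrite normc_conj.
by rewrite normcV invf_le1// ?ltW// (lt_trans ltr01).
Qed.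

(** If |z| <= 1, multiply 1 - z conj x by x and use x conj x = 1; otherwise |1 - x/z| |z| = |z -
    x|. *)
Lemma normc_1B_into_disc z x : normc x = 1 ->
  normc (1 - into_disc z * x) * Num.max 1 (normc z) = normc (x - z).
Proof.
move=> x1; have x0 : x != 0.
  by apply/eqP => x0; move: x1; rewrite x0 normc0; lra.
rewrite /into_disc; case: (lerP (normc z) 1) => h.
  rewrite mulr1 -normc_conj -[LHS]mul1r -{1}x1 -normcM rmorphB/= rmorph1 rmorphM/= conjCK.
  by rewrite mulrBr mulr1 mulrCA -normc_sqrC x1 expr1n mulr1.
have z0 : z != 0 by apply/eqP => z0; move: h; rewrite z0 normc0; lra.
by rewrite -normcM mulrBl mul1r mulrAC mulVf// mul1r distcC.
Qed.

Definition disc_poly rs : {poly R[i]} := \prod_(z <- rs) (1 - into_disc z *: 'X).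

Lemma horner_disc_poly rs x : (disc_poly rs).[x] = \prod_(z <- rs) (1 - into_disc z * x).
Proof. by rewrite horner_prod; apply: eq_bigr => z _; rewrite !hornerE. Qed.

Lemma size_disc_poly rs : (size (disc_poly rs) <= (size rs).+1)%N.
Proof.
rewrite /disc_poly; elim: rs => [|z rs IH]; first by rewrite big_nil size_poly1.
rewrite big_cons (leq_trans (size_polyMleq _ _))//=.
have : (size (1 - into_disc z *: 'X)%R <= 2)%N.
  rewrite (leq_trans (size_polyD _ _))// size_poly1 size_polyN geq_max/=.
  by rewrite (leq_trans (size_scale_leq _ _))// size_polyX.
by move=> h; have := leq_add h IH; case: (_ + _)%N.
Qed.

Variables (rs : seq R[i]) (S : R).
Hypothesis hS : \sum_(i < (size rs).+1) normc (\prod_(z <- rs) ('X - z%:P))`_i <= S.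

Lemma circle_bound x : normc x = 1 ->
  normc (disc_poly rs).[x] * \prod_(z <- rs) Num.max 1 (normc z) <= S.
Proof.
move=> x1; rewrite horner_disc_poly normc_prod -big_split/=.
under eq_bigr do rewrite normc_1B_into_disc//.
rewrite -normc_prod (le_trans _ hS)//.
have -> : \prod_(z <- rs) (x - z) = (\prod_(z <- rs) ('X - z%:P)).[x].
  by rewrite horner_prod; apply: eq_bigr => z _; rewrite !hornerE.
rewrite horner_coef size_prod_XsubC (le_trans (normc_sum _ _ _))//.
by apply: ler_sum => i _; rewrite normcM normcX x1 expr1n mulr1.
Qed.

Let max_ge1 : 1 <= \prod_(z <- rs) Num.max 1 (normc z).
Proof.
elim/big_ind: _ => // [u v u1 v1|z _]; last by rewrite le_max lexx.
by rewrite -[1]mulr1 ler_pM.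
Qed.

Lemma coef_disc_poly_le i :
  normc (disc_poly rs)`_i * \prod_(z <- rs) Num.max 1 (normc z) <= S.
Proof.
have p0 := lt_le_trans ltr01 max_ge1.
rewrite -ler_pdivlMr//; apply: coef_le_circle => x x1.
by rewrite ler_pdivlMr// circle_bound.
Qed.

(** The product is the Mahler measure of the monic polynomial; the bound is the previous one at the
    constant coefficient of [disc_poly], which is 1. *)
Lemma mahler_le : \prod_(z <- rs) Num.max 1 (normc z) <= S.
Proof.
have := coef_disc_poly_le 0; rewrite -horner_coef0 horner_disc_poly.
by rewrite big1 ?normc1 ?mul1r// => z _; rewrite mulr0 subr0.
Qed.

Lemma S_ge0 : 0 <= S.
Proof. by rewrite (le_trans _ mahler_le)// (le_trans ler01 max_ge1). Qed.

Lemma disc_poly_disc x : normc x <= 1 ->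
  normc (disc_poly rs).[x] <= (size rs).+1%:R * S.
Proof.
move=> x1; rewrite (@horner_coef_wide _ (size rs).+1) ?size_disc_poly//.
rewrite (le_trans (normc_sum _ _ _))// mulr_natl.
rewrite -[in leRHS](card_ord (size rs).+1) -sumr_const ler_sum// => i _.
rewrite normcM normcX.
apply: (@le_trans _ _ (normc (disc_poly rs)`_i)).
  by rewrite ler_piMr ?normc_ge0 ?exprn_ile1 ?normc_ge0.
apply: le_trans (coef_disc_poly_le i).
by rewrite ler_peMr ?normc_ge0.
Qed.

Lemma prod_1B_into_discX_le k v : (0 < k)%N -> normc v <= 1 ->
  \prod_(z <- rs) normc (1 - into_disc z ^+ k * v) <= ((size rs).+1%:R * S) ^+ k.
Proof.
(* With w^k = v, the factors 1 - b w zeta^i for i < k multiply to 1 - b^k v, and every w zeta^i lies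
   in the disc. *)
move=> k0 v1; pose w := k.-root v.
have wk : w ^+ k = v by rewrite rootCK.
have w1 : normc w <= 1.
  by rewrite -(@ler_pXn2r _ k) ?nnegrE ?normc_ge0// expr1n -normcX wk.
have -> : \prod_(z <- rs) normc (1 - into_disc z ^+ k * v) =
    \prod_(i < k) normc (disc_poly rs).[w * zeta R k ^+ i].
  under [RHS]eq_bigr do rewrite horner_disc_poly normc_prod.
  rewrite exchange_big/=; apply: eq_bigr => z _.
  under eq_bigr do rewrite mulrA.
  by rewrite -normc_prod prod_1B_zeta// exprMn wk.
rewrite -[X in _ ^+ X]card_ord -prodr_const; apply: ler_prod => i _.
rewrite normc_ge0/=; apply: disc_poly_disc.
by rewrite normcM normc_zeta mulr1.
Qed.

Lemma into_disc_power_sum k eta : (0 < k)%N -> 0 < eta <= 4^-1 ->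
  (size rs).+1%:R * S <= expR (eta ^+ 2 * (size rs)%:R) ->
  normc (\sum_(z <- rs) into_disc z ^+ k) <= (8 + k%:R) * eta * (size rs)%:R.
Proof.
move=> k0 /andP[eta0 eta4] hA; set s := \sum_(z <- rs) _; set d := (size rs)%:R.
have [->|s0] := eqVneq s 0.
  by rewrite normc0 !mulr_ge0// ?ltW// addr_ge0.
have ns0 := normc_gt0 s0.
(* The point of modulus eta with s v = - eta |s|, which makes the lower bound exp (eta |s| - 8 eta^2
   d) as large as possible. *)
pose v := - (real_complex R (eta / normc s) * s^*).
have nv : normc v = eta.
  rewrite normcN normcM normc_real normc_conj ger0_norm ?divr_ge0 ?ltW//.
  by rewrite mulfVK// gt_eqF.
have Resv : complex.Re (s * v) = - (eta * normc s).
  rewrite /v mulrN mulrCA -normc_sqrC -rmorphM/=; congr (- _).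
  by rewrite expr2 mulrA mulfVK// gt_eqF.
have v1 : normc v <= 1 by rewrite nv; lra.
have := prod_1B_into_discX_le k0 v1.
have lo : expR (eta * normc s - 8 * eta ^+ 2 * d) <=
    \prod_(z <- rs) normc (1 - into_disc z ^+ k * v).
  have -> : eta * normc s - 8 * eta ^+ 2 * d =
     \sum_(z <- rs) (- complex.Re (into_disc z ^+ k * v) - 8 * eta ^+ 2).
    rewrite big_split/= sumrN -[eta * _]opprK -Resv /s mulr_suml.
    rewrite (raddf_sum (@complex.Re R)); congr (_ + _).
    by rewrite big_const_seq count_predT iter_addr_0 -mulNr mulr_natr.
  rewrite expR_sum; apply: ler_prod => z _; rewrite expR_ge0/=.
  have rk : normc (into_disc z ^+ k * v) <= eta.
    by rewrite normcM nv normcX ler_piMl ?(ltW eta0)// exprn_ile1 ?normc_ge0 ?into_disc_le1.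
  apply: le_trans (normc_1B_ge _); last exact: le_trans rk eta4.
  rewrite ler_expR lerD2l lerN2 ler_wpM2l// lerXn2r ?nnegrE ?normc_ge0//.
  exact: ltW.
move=> hi; have := le_trans lo hi.
have hA' : ((size rs).+1%:R * S) ^+ k <= expR (eta ^+ 2 * d * k%:R).
  by rewrite expRM_natr lerXn2r ?nnegrE ?expR_ge0 ?mulr_ge0 ?S_ge0.
move=> /le_trans/(_ hA'); rewrite ler_expR => h.
rewrite -(ler_pM2l eta0); move: h; rewrite -/d; lra.
Qed.

End IntoDisc.

(** * Projection of the roots onto the circle *)

Section Unitization.
Variable R : realType.
Implicit Types (x z : R[i]) (rs : seq R[i]).

(** Splitting off the zero roots gives f = X^c g, where g(0) is the product of the - z over the
    nonzero roots. *)
Lemma prod_XsubC_low rs (c : nat) :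
  let f := \prod_(z <- rs) ('X - z%:P) in
  (forall i, (i < c)%N -> f`_i = 0) -> f`_c != 0 ->
  count (pred1 0) rs = c /\ normc f`_c = \prod_(z <- rs | z != 0) normc z.
Proof.
move=> f low fc; pose g := \prod_(z <- rs | z != 0) ('X - z%:P).
have fE : f = 'X^(count (pred1 0) rs) * g.
  rewrite /f (bigID (pred1 0))/=; congr (_ * _).
  rewrite (eq_bigr (fun=> 'X)) => [|z /eqP ->]; last by rewrite subr0.
  by rewrite big_const_seq iter_mulr_1.
have g0 : normc g`_0 = \prod_(z <- rs | z != 0) normc z.
  rewrite -horner_coef0 horner_prod normc_prod; apply: eq_bigr => z _.
  by rewrite !hornerE normcN.
have g0n0 : g`_0 != 0.
  apply/eqP => g00; have /esym/eqP := g0; rewrite g00 normc0.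
  rewrite prodf_seq_eq0 => /hasP[z _ /andP[z0 /eqP /eq0_normc zz]].
  by rewrite zz eqxx in z0.
suff cE : count (pred1 0) rs = c.
  by split => //; rewrite fE -cE coefXnM ltnn subnn g0.
have [cc|cc|//] := ltngtP (count (pred1 0) rs) c.
  have := low _ cc; rewrite fE coefXnM ltnn subnn => h.
  by rewrite h eqxx in g0n0.
by move: fc; rewrite fE coefXnM cc eqxx.
Qed.

(** The value 1 at 0 keeps the image on the circle; for eta < 1 a zero root counts as
    [off_circle]. *)
Definition unitize z : R[i] :=
  if z == 0 then 1 else z / real_complex R (normc z).

Lemma normc_unitize z : normc (unitize z) = 1.
Proof.
rewrite /unitize; case: eqVneq => [_|z0]; first exact: normc1.
have nz := normc_gt0 z0.
by rewrite normcM normcV normc_real ger0_norm ?ltW// mulfV// gt_eqF.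
Qed.

Lemma unitizeE z : z = real_complex R (normc z) * unitize z.
Proof.
rewrite /unitize; case: eqVneq => [->|z0]; first by rewrite normc0 mul0r.
by rewrite mulrCA mulfV ?mulr1// -(rmorph0 (real_complex R)) (inj_eq (@complexI R))
  gt_eqF// normc_gt0.
Qed.

Lemma into_discE z : into_disc z = real_complex R (normc (into_disc z)) * (unitize z)^*.
Proof.
rewrite [in LHS]/into_disc; case: ifPn => h.
  rewrite /into_disc h normc_conj [in LHS](unitizeE z) rmorphM/=; congr (_ * _).
  by rewrite -[X in X^*]normrE_normc conj_Creal ?normr_real// normrE_normc.
rewrite /into_disc (negPf h) normcV [in LHS](unitizeE z) invfM.
by rewrite (norm_inv_conj (normc_unitize z)) fmorphV.
Qed.

(** Relates the lowest coefficient, a product of the |z|, to the Mahler measure and the |b(z)|. *)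
Lemma normc_into_disc_max z : normc (into_disc z) * Num.max 1 (normc z) ^+ 2 = normc z.
Proof.
rewrite /into_disc; case: (lerP (normc z) 1) => [h|h].
  by rewrite normc_conj expr1n mulr1.
by rewrite normcV expr2 mulrA mulVf ?mul1r// gt_eqF// (lt_trans ltr01).
Qed.

Definition off_circle (eta : R) z : bool := normc (into_disc z) < 1 - eta.

Lemma dist_unitize eta z : 0 < eta <= 4^-1 -> ~~ off_circle eta z ->
  normc (z - unitize z) <= 2 * eta.
Proof.
move=> /andP[e0 e4]; rewrite /off_circle -leNgt => h.
have -> : normc (z - unitize z) = `|normc z - 1|.
  rewrite {1}(unitizeE z) -[X in _ - X]mul1r -mulrBl normcM normc_unitize mulr1.
  by rewrite -(rmorph1 (real_complex R)) -rmorphB normc_real.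
move: h; rewrite /into_disc; case: (lerP (normc z) 1) => [z1|z1].
  by rewrite normc_conj => h; lra.
have z0 : 0 < normc z by lra.
rewrite normcV -[X in _ <= X]div1r ler_pdivlMr// => h.
nra.
Qed.

Variables (rs : seq R[i]) (S eta : R) (c : nat).
Let d : R := (size rs)%:R.
Let f := \prod_(z <- rs) ('X - z%:P).
Hypothesis eta_bd : 0 < eta <= 4^-1.
Hypothesis hS : \sum_(i < (size rs).+1) normc f`_i <= S.
Hypothesis S_le : (size rs).+1%:R * S <= expR (eta ^+ 2 * d).
Hypothesis c_le : c%:R <= eta * d.
Hypothesis low : forall i, (i < c)%N -> f`_i = 0.
Hypothesis fc_ge : expR (- (eta ^+ 2 * d)) <= normc f`_c.

(** At most c <= eta d roots are zero. If k nonzero roots are off the circle, then exp (- eta^2 d)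
    <= |f_c| <= S^2 (1 - eta)^k <= exp (2 eta^2 d - eta k), so k <= 3 eta d. *)
Lemma off_circle_le : \sum_(z <- rs) (off_circle eta z)%:R <= 4 * eta * d.
Proof.
have /andP[e0 e4] := eta_bd.
have fc0 : f`_c != 0.
  apply/eqP => fc0; move: fc_ge; rewrite fc0 normc0 leNgt.
  by rewrite expR_gt0.
have [cE fcE] := prod_XsubC_low low fc0.
rewrite (bigID (pred1 0))/= (_ : 4 * eta * d = eta * d + 3 * (eta * d)); last by ring.
apply: lerD.
  apply: le_trans c_le; rewrite -cE -sum1_count natr_sum.
  by apply: ler_sum => z _; rewrite ler_nat leq_b1.
have SE : S <= expR (eta ^+ 2 * d).
  apply: le_trans S_le; rewrite ler_peMl ?ler1n//; exact: S_ge0 hS.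
have h1 : normc f`_c <= S ^+ 2 * \prod_(z <- rs | z != 0) normc (into_disc z).
  rewrite fcE; under eq_bigr do rewrite -normc_into_disc_max.
  rewrite big_split/= mulrC ler_wpM2r ?prodr_ge0// => [z _|].
    exact: normc_ge0.
  rewrite prodrXl lerXn2r ?nnegrE ?(S_ge0 hS)//.
    by apply: prodr_ge0 => z _; rewrite le_max ler01.
  apply: le_trans (mahler_le hS); rewrite [leRHS](bigID (pred1 0))/=.
  rewrite [X in _ <= X * _]big1 ?mul1r// => z /eqP ->.
  by rewrite normc0 max_l.
have h2 : \prod_(z <- rs | z != 0) normc (into_disc z) <=
    expR (- (eta * \sum_(z <- rs | z != 0) (off_circle eta z)%:R)).
  rewrite mulr_sumr -sumrN expR_sum; apply: ler_prod => z _.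
  rewrite normc_ge0/=; have [h|_] := boolP (off_circle eta z); last first.
    by rewrite mulr0 oppr0 expR0 into_disc_le1.
  by rewrite mulr1 (le_trans (ltW h))// expR_ge1Dx.
have hS2 : S ^+ 2 <= expR (2 * (eta ^+ 2 * d)).
  by rewrite expRM_natl lerXn2r ?nnegrE ?expR_ge0 ?(S_ge0 hS).
have : expR (- (eta ^+ 2 * d)) <= expR (2 * (eta ^+ 2 * d)) *
    expR (- (eta * \sum_(z <- rs | z != 0) (off_circle eta z)%:R)).
  apply: le_trans fc_ge _; apply: le_trans h1 _; apply: ler_pM => //.
    exact: sqr_ge0.
  by apply: prodr_ge0 => z _; exact: normc_ge0.
rewrite -expRD ler_expR => h3.
rewrite -(ler_pM2l e0); lra.
Qed.

(** Compared with the power sum of the b(z), a root costs 1 - |b(z)|^k: at most k eta near the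
    circle by Bernoulli, and at most 1 for the 4 eta d others. Adding 8 + k from
    [into_disc_power_sum] gives 12 + 2k. *)
Lemma unit_power_sum k : (0 < k)%N ->
  normc (\sum_(z <- rs) unitize z ^+ k) <= (12 + 2 * k%:R) * eta * d.
Proof.
move=> k0; have /andP[e0 e4] := eta_bd.
rewrite -normc_conj rmorph_sum/=.
have -> : \sum_(z <- rs) (unitize z ^+ k)^* =
    \sum_(z <- rs) into_disc z ^+ k + \sum_(z <- rs) ((unitize z ^+ k)^* - into_disc z ^+ k).
  by rewrite -big_split/=; apply: eq_bigr => z _; rewrite addrC subrK.
apply: (le_trans (le_normcD _ _)).
have hr := into_disc_power_sum hS k0 eta_bd S_le.
rewrite -/d in hr.
suff h : normc (\sum_(z <- rs) ((unitize z ^+ k)^* - into_disc z ^+ k)) <=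
    k%:R * eta * d + 4 * eta * d by lra.
apply: (le_trans (normc_sum _ _ _)).
apply: (@le_trans _ _ (\sum_(z <- rs) (k%:R * eta + (off_circle eta z)%:R))); last first.
  rewrite big_split/= lerD ?off_circle_le//.
  by rewrite big_const_seq count_predT iter_addr_0 -[leLHS]mulr_natr.
apply: ler_sum => z _; set r := normc (into_disc z).
have r0 : 0 <= r := normc_ge0 _.
have r1 : r <= 1 := into_disc_le1 z.
have -> : normc ((unitize z ^+ k)^* - into_disc z ^+ k) = 1 - r ^+ k.
  rewrite [X in _ - X ^+ _]into_discE exprMn rmorphXn/= -[X in X - _]mul1r -mulrBl.
  rewrite normcM normcX normc_conj normc_unitize expr1n mulr1.
  rewrite -rmorphXn -(rmorph1 (real_complex R)) -rmorphB normc_real ger0_norm//.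
  by rewrite subr_ge0 exprn_ile1.
have bern : 1 - r ^+ k <= k%:R * (1 - r).
  elim: (k) => [|n IH]; first by rewrite expr0 subrr mul0r.
  rewrite exprS -natr1 mulrDl mul1r.
  have := exprn_ge0 n r0; have := exprn_ile1 n r0 r1.
  by nra.
have [h|] := boolP (off_circle eta z).
  have := exprn_ge0 k r0; have : 0 <= k%:R * eta by rewrite mulr_ge0// ltW.
  by rewrite /=; lra.
rewrite /off_circle -/r -leNgt addr0 => h; apply: le_trans bern _.
by apply: ler_wpM2l => //; lra.
Qed.
End Unitization.

(** * Discrete Fejer summation *)

Section Fejer.
Variables (R : realType) (M : nat).
Hypothesis M0 : (0 < M)%N.
Implicit Types (x y z u : R[i]).

(** The Fejer kernel, normalized so that its values at the M rotated nodes sum to 1. *)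
Definition fejer y : R := normc (\sum_(l < M) y ^+ l) ^+ 2 / M%:R ^+ 2.

Let Mr0 : 0 < M%:R :> R. Proof. by rewrite ltr0n. Qed.

Lemma fejer_ge0 y : 0 <= fejer y.
Proof. by rewrite divr_ge0 ?sqr_ge0. Qed.

Lemma fejer_expand y : normc y = 1 ->
  real_complex R (M%:R ^+ 2 * fejer y) = \sum_(a < M) \sum_(b < M) y ^+ a / y ^+ b.
Proof.
move=> y1; rewrite /fejer mulrC divfK ?expf_neq0 ?gt_eqF//.
rewrite normc_sqrC rmorph_sum mulr_suml; apply: eq_bigr => a _.
rewrite mulr_sumr; apply: eq_bigr => b _.
by rewrite norm_inv_conj// normcX y1 expr1n.
Qed.

Lemma sum_fejer u : normc u = 1 -> \sum_(j < M) fejer (u / zeta R M ^+ j) = 1.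
Proof.
move=> u1; have u0 : u != 0 by apply/eqP => u0; move: u1; rewrite u0 normc0; lra.
apply: (mulfI (expf_neq0 2 (lt0r_neq0 Mr0))).
apply: (@complexI R); rewrite mulr_sumr rmorph_sum/=.
under eq_bigr do rewrite fejer_expand ?normcM ?u1 ?normcV ?normc_zeta ?invr1 ?mulr1//.
rewrite exchange_big/= mulr1 rmorphXn rmorph_nat/= expr2 -[X in X%:R * _](card_ord M).
rewrite mulr_natl -sumr_const; apply: eq_bigr => a _.
rewrite exchange_big/= (bigD1 a)//= [X in _ + X]big1 ?addr0 => [|b ba].
  under eq_bigr => j _.
    rewrite mulfV; first over.
    rewrite expf_neq0// mulf_neq0 ?invr_eq0//; apply/eqP => z0.
    by have := normc_zeta R M j; rewrite z0 normc0; lra.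
  by rewrite sumr_const card_ord.
under eq_bigr do
  rewrite !expr_div_n invf_div mulf_div [X in _ / X]mulrC -mulf_div.
by rewrite -mulr_sumr sum_zetaX_neq ?mulr0// eq_sym.
Qed.

Lemma fejer_far y delta : 0 < delta -> normc y = 1 -> delta <= normc (1 - y) ->
  fejer y <= 4 / (M%:R ^+ 2 * delta ^+ 2).
Proof.
move=> d0 y1 hy; rewrite /fejer.
set s := \sum_(_ < _) _.
have h : normc (1 - y) * normc s <= 2.
  rewrite -normcM -opprB mulNr -subrX1 normcN (le_trans (le_normcD _ _))//.
  by rewrite normcN normcX y1 expr1n normc1.
have hs : delta * normc s <= 2.
  by rewrite (le_trans _ h)// ler_wpM2r ?normc_ge0.
rewrite [leRHS](_ : _ = 4 / delta ^+ 2 / M%:R ^+ 2); last first.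
  by rewrite -mulrA -invfM [X in _ / X]mulrC.
rewrite ler_wpM2r ?invr_ge0 ?sqr_ge0//.
rewrite ler_pdivlMr ?exprn_gt0// mulrC -exprMn.
have : 0 <= delta * normc s by rewrite mulr_ge0 ?normc_ge0 ?ltW.
by nra.
Qed.

Variables (phi : R[i] -> R) (B delta omega : R).
Hypothesis delta0 : 0 < delta.
Hypothesis omega0 : 0 <= omega.
Hypothesis phiB : forall z, `|phi z| <= B.
Hypothesis phi_unif : forall u v, normc u = 1 ->
  normc (v - u) < delta -> `|phi v - phi u| <= omega.

(** Nodes within delta of u cost omega in total; each of the at most M others costs 2B times the
    kernel bound 4 / (M delta)^2. *)
Lemma fejer_approx u : normc u = 1 ->
  `|phi u - \sum_(j < M) phi (zeta R M ^+ j) * fejer (u / zeta R M ^+ j)| <=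
  omega + 8 * B / (M%:R * delta ^+ 2).
Proof.
move=> u1; rewrite -[X in X - _]mulr1 -{1}(sum_fejer u1) mulr_sumr -sumrB.
have B0 : 0 <= B by rewrite (le_trans _ (phiB 0)).
have e0 : 0 <= 8 * B / (M%:R ^+ 2 * delta ^+ 2).
  by rewrite !mulr_ge0// invr_ge0 mulr_ge0 ?sqr_ge0.
apply: (le_trans (ler_norm_sum _ _ _)).
apply: (@le_trans _ _ (\sum_(j < M) (omega * fejer (u / zeta R M ^+ j) +
    8 * B / (M%:R ^+ 2 * delta ^+ 2)))); last first.
  rewrite big_split/= -mulr_sumr sum_fejer// mulr1 lerD2l sumr_const card_ord.
  rewrite -[leLHS]mulr_natr le_eqVlt; apply/orP; left; apply/eqP.
  by field; rewrite !gt_eqF.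
apply: ler_sum => j _; rewrite -mulrBl normrM (ger0_norm (fejer_ge0 _)).
have z1 := normc_zeta R M j.
have [h|h] := ltrP (normc (u - zeta R M ^+ j)) delta.
  by rewrite -[leLHS]addr0 lerD// ler_wpM2r ?fejer_ge0// phi_unif.
rewrite -[leLHS]add0r; apply: lerD; first by rewrite mulr_ge0 ?fejer_ge0.
have z0 : zeta R M ^+ j != 0.
  by apply/eqP => z0; move: z1; rewrite z0 normc0; lra.
have hf : fejer (u / zeta R M ^+ j) <= 4 / (M%:R ^+ 2 * delta ^+ 2).
  apply: fejer_far => //; first by rewrite normcM normcV u1 z1 invr1 mulr1.
  rewrite -[1](mulfV z0) -mulrBl normcM normcV z1 invr1 mulr1.
  by rewrite distcC.
rewrite [leRHS](_ : _ = (2 * B) * (4 / (M%:R ^+ 2 * delta ^+ 2))); last by ring.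
apply: ler_pM => //; first exact: fejer_ge0.
by rewrite mulr_natl mulr2n (le_trans (ler_normB _ _))// lerD.
Qed.

Variables (rs : seq R[i]) (T : R).
Hypothesis T0 : 0 <= T.
Hypothesis powT : forall k, (0 < k < M)%N ->
  normc (\sum_(z <- rs) unitize z ^+ k) <= T.

(** In the expanded kernel the diagonal gives d / M, and the other terms are power sums with
    exponents of absolute value between 1 and M - 1, negative ones being handled by conjugation. *)
Lemma sum_fejer_roots j :
  `|\sum_(z <- rs) fejer (unitize z / zeta R M ^+ j) - (size rs)%:R / M%:R| <= T.
Proof.
pose y z := unitize z / zeta R M ^+ j.
have y1 z : normc (y z) = 1.
  by rewrite normcM normcV normc_unitize normc_zeta invr1 mulr1.
have y0 z : y z != 0 by apply/eqP => z0; have := y1 z; rewrite z0 normc0; lra.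
have hT k : (0 < k < M)%N -> normc (\sum_(z <- rs) y z ^+ k) <= T.
  move=> kM; under eq_bigr do rewrite expr_div_n.
  by rewrite -mulr_suml normcM normcV normcX normc_zeta expr1n invr1 mulr1 powT.
have M2 : 0 < M%:R ^+ 2 :> R by rewrite exprn_gt0.
rewrite -(ler_pM2l M2) -[X in X * `|_|](gtr0_norm M2) -normrM -normc_real.
rewrite mulrBr mulr_sumr rmorphB rmorph_sum/=.
under eq_bigr => z _ do
  rewrite (fejer_expand (y1 z : normc (unitize z / zeta R M ^+ j) = 1)) -/(y z).
rewrite exchange_big/=; under eq_bigr do rewrite exchange_big/=.
have -> : real_complex R (M%:R ^+ 2 * ((size rs)%:R / M%:R)) =
    \sum_(a < M) (size rs)%:R.
  rewrite sumr_const card_ord -[RHS]mulr_natr expr2 mulrACA -mulrA mulfV ?gt_eqF// mulr1.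
  by rewrite rmorphM/= !rmorph_nat mulrC.
rewrite -sumrB; apply: (le_trans (normc_sum _ _ _)).
have -> : M%:R ^+ 2 * T = \sum_(a < M) (M%:R * T).
  by rewrite sumr_const card_ord -[RHS]mulr_natl mulrA expr2.
apply: ler_sum => a _.
rewrite (bigD1 a)//= addrAC (_ : \sum_(i <- rs) _ = (size rs)%:R) ?subrr ?add0r; last first.
  under eq_bigr do rewrite mulfV ?expf_neq0//.
  by rewrite big_const_seq count_predT iter_addr_0.
apply: (le_trans (normc_sum _ _ _)).
apply: (@le_trans _ _ (\sum_(b < M | b != a) T)); last first.
  rewrite sumr_const -[leLHS]mulr_natl.
  by rewrite ler_wpM2r // ler_nat (leq_trans (max_card _))// card_ord.
apply: ler_sum => b ba.
have y_inv z : (y z)^-1 = (y z)^* by rewrite norm_inv_conj.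
have [ab|ab] := ltnP a b.
  rewrite -normc_conj rmorph_sum/=.
  under eq_bigr => z _ do
    rewrite rmorphM fmorphV !rmorphXn/= -y_inv !exprVn invrK mulrC -expfB//.
  by apply: hT; have := ltn_ord b; lia.
have {}ab : (b < a)%N by rewrite ltn_neqAle ab andbT.
under eq_bigr => z _ do rewrite -expfB//.
by apply: hT; have := ltn_ord a; lia.
Qed.

Lemma mean_unitize_le :
  `|\sum_(z <- rs) phi (unitize z) -
    (size rs)%:R / M%:R * \sum_(j < M) phi (zeta R M ^+ j)| <=
  (size rs)%:R * (omega + 8 * B / (M%:R * delta ^+ 2)) + M%:R * B * T.
Proof.
have B0 : 0 <= B by rewrite (le_trans _ (phiB 0)).
pose P z := \sum_(j < M) phi (zeta R M ^+ j) * fejer (unitize z / zeta R M ^+ j).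
rewrite -[X in `|X|](subrKA (\sum_(z <- rs) P z)) (le_trans (ler_normD _ _))// lerD//.
  rewrite -sumrB (le_trans (ler_norm_sum _ _ _))//.
  apply: (le_trans (ler_sum _ (fun z _ => fejer_approx (normc_unitize z)))).
  by rewrite big_const_seq count_predT iter_addr_0 -[leLHS]mulr_natl.
rewrite /P exchange_big/= mulr_sumr -sumrB (le_trans (ler_norm_sum _ _ _))//.
have -> : M%:R * B * T = \sum_(j < M) B * T.
  by rewrite sumr_const card_ord -[RHS]mulr_natl mulrA.
apply: ler_sum => j _; rewrite -mulr_sumr mulrC -mulrBl normrM mulrC.
by rewrite ler_pM// sum_fejer_roots.
Qed.

End Fejer.

(** * Integrals *)

Section RiemannSum.
Variables (R : realType) (g : R -> R).
Hypothesis cg : continuous g.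
Let mu := @lebesgue_measure R.

(** The base point -1 makes the primitive differentiable on both sides at 0. *)
Let G (x : R) : R := (\int[mu]_(t in `[(-1)%R, x]) g t)%R.

Let G_derive (x : R) : 0 <= x -> is_derive x 1 G (g x).
Proof.
move=> x0; have xu : x < x + 1 by rewrite ltrDl.
have ig : mu.-integrable `[(-1)%R, x + 1] (EFin \o g).
  apply: continuous_compact_integrable; first exact: segment_compact.
  exact: continuous_subspaceT.
have ax : -1 < x by rewrite (lt_le_trans _ x0)// ltrN10.
have [dG eG] := continuous_FTC1_closed xu ig ax (@cg x).
by split; [exact: dG|rewrite -derive1E].
Qed.

Let G_cts (x : R) : 0 <= x -> {for x, continuous G}.
Proof.
move=> x0; apply: differentiable_continuous; apply/derivable1_diffP.
by have := G_derive x0 => -[].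
Qed.

Let G_within a b : 0 <= a -> {within `[a, b], continuous G}.
Proof.
move=> a0; apply: continuous_in_subspaceT => x; rewrite inE/= in_itv/=.
by move=> /andP[ax _]; apply: G_cts; exact: le_trans ax.
Qed.

(** By the mean value theorem for G, the average of g over each subinterval is a value of g there,
    within w of the value at the left end. *)
Lemma riemann_sum_le (L w : R) (M : nat) : 0 < L -> (0 < M)%N ->
  (forall s t, 0 <= s -> s <= t -> t <= s + L / M%:R -> `|g t - g s| <= w) ->
  exists2 I : R, (\int[mu]_(t in `[0%R, L]) (g t)%:E)%E = I%:E &
   `|L^-1 * I - M%:R^-1 * \sum_(j < M) g (L * j%:R / M%:R)| <= w.
Proof.
move=> L0 M0 hw; exists (G L - G 0).
  rewrite EFinB; apply: continuous_FTC2 => //.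
  - exact: continuous_subspaceT.
  - split.
    + by move=> x /itvP x0L; have := @G_derive x => -[]//; rewrite x0L.
    + by apply: cvg_at_right_filter; exact: G_cts.
    + by apply: cvg_at_left_filter; apply: G_cts; exact: ltW.
  - move=> x /itvP x0L; rewrite derive1E.
    by have [|_ ->//] := @G_derive x; rewrite x0L.
have Mr0 : 0 < M%:R :> R by rewrite ltr0n.
pose t (j : nat) : R := L * j%:R / M%:R.
have t0 j : 0 <= t j by rewrite !mulr_ge0// ?invr_ge0 ltW.
have tS j : t j.+1 = t j + L / M%:R by rewrite /t -natr1 mulrDr mulr1 mulrDl.
have -> : G L - G 0 = \sum_(j < M) (G (t j.+1) - G (t j)).
  rewrite -(big_mkord xpredT (fun j => G (t j.+1) - G (t j))) telescope_sumr//.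
  by rewrite /t mulr0 mul0r mulfK// gt_eqF.
have -> : L^-1 * \sum_(j < M) (G (t j.+1) - G (t j)) =
    M%:R^-1 * \sum_(j < M) (M%:R / L * (G (t j.+1) - G (t j))).
  by rewrite -mulr_sumr !mulrA mulVf ?gt_eqF// mul1r.
rewrite -mulrBr -sumrB normrM gtr0_norm ?invr_gt0// mulrC ler_pdivrMr//.
apply: (le_trans (ler_norm_sum _ _ _)).
have -> : w * M%:R = \sum_(j < M) w by rewrite sumr_const card_ord mulr_natr.
apply: ler_sum => j _.
have tt : t j <= t j.+1 by rewrite tS lerDl divr_ge0// ltW.
have [||c cj ->] := @MVT_segment R G g _ _ tt.
- by move=> x /itvP xj; apply: G_derive; rewrite (le_trans (t0 j))// xj.
- exact: G_within.
rewrite tS addrAC subrr add0r.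
rewrite mulrCA mulf_div [M%:R * L]mulrC mulfV ?mulf_neq0 ?gt_eqF// mulr1.
by apply: hw; rewrite -?tS ?(itvP cj)// t0.
Qed.
End RiemannSum.

(** * Uniform continuity near the unit circle *)

Section PlaneTopology.
Variable R : realType.

Lemma cis_onto (u : R[i]) : normc u = 1 -> exists2 t, -pi <= t <= pi & cis t = u.
Proof.
case: u => a b u1; have ab : a ^+ 2 + b ^+ 2 = 1.
  by have := normc_sqr (Complex a b); rewrite u1 expr1n /= => <-.
have a1 : -1 <= a <= 1 by apply/andP; split; nra.
have ac0 := acos_ge0 a1; have acpi := acos_lepi a1.
have sb : sin (acos a) = `|b|.
  by rewrite sin_acos// -sqrtr_sqr; congr (Num.sqrt _); lra.
have ca : cos (acos a) = a by rewrite acosK// in_itv.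
have [b0|b0] := lerP 0 b.
  exists (acos a); first by rewrite acpi andbT (le_trans _ ac0)// oppr_le0 pi_ge0.
  by rewrite /cis ca sb ger0_norm.
exists (- acos a).
  by rewrite lerN2 acpi/= (le_trans _ (pi_ge0 R))// oppr_le0.
by rewrite /cis cosN sinN ca sb ltr0_norm// opprK.
Qed.

Lemma nbhs_normcP (x : (R[i])^o) (P : set (R[i])^o) : nbhs x P <->
  exists2 e : R, 0 < e & forall y : R[i], normc (y - x) < e -> P y.
Proof.
split=> [/nbhs_normP[e /= e0 he]|[e e0 he]].
  have eE : e = real_complex R (complex.Re e) by rewrite RRe_real// gtr0_real.
  exists (complex.Re e); first by move: e0; rewrite {1}eE (ltcR 0).
  by move=> y yx; apply: he => /=; rewrite normrE_normc distcC eE ltcR.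
apply: (proj2 (@nbhs_normP _ (R[i])^o x P)); exists (real_complex R e); first by rewrite /= (ltcR 0).
by move=> y /=; rewrite normrE_normc ltcR distcC => /he.
Qed.

Lemma continuous_cis (t e : R) : 0 < e ->
  \forall s \near t, normc (cis s - cis t) < e.
Proof.
move=> e0; apply: (@continuous_expi R t [set z | normc (z - cis t) < e]).
by apply/nbhs_normcP; exists e.
Qed.

(** Heine's argument on the compact interval of angles. Only u lies on the circle: v is any nearby
    point of the plane, such as a root. *)
Lemma unif_continuous_circle (phi : R[i] -> R) :
  continuous (phi : (R[i])^o -> R) -> forall w, 0 < w ->
  exists2 delta : R, 0 < delta & forall u v : R[i], normc u = 1 ->
    normc (v - u) < delta -> `|phi v - phi u| <= w.
Proof.
move=> cphi w w0.
pose P (delta t : R) := forall v : R[i], normc (v - cis t) < delta ->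
  `|phi v - phi (cis t)| <= w.
have K := @segment_compact R (- pi) pi.
have /compact_near_coveringP cov := K.
have : \forall delta \near 0^'+, `[-pi, pi] `<=` P delta.
  apply: cov => t _.
  have /cvgrPdist_lt/(_ (w / 2)) := @cphi (cis t).
  move=> /(_ (divr_gt0 w0 (ltr0Sn _ _)))/nbhs_normcP[e e0 he].
  near=> s delta => v vs.
  have st : normc (cis s - cis t) < e / 2.
    near: s; apply: continuous_cis; exact: divr_gt0.
  have de : delta < e / 2.
    near: delta; apply: nbhs_right_lt; exact: divr_gt0.
  have h1 : `|phi (cis t) - phi (cis s)| < w / 2.
    by apply: he; rewrite (lt_trans st)//; lra.
  have h2 : `|phi (cis t) - phi v| < w / 2.
    apply: he; rewrite (_ : v - cis t = (v - cis s) + (cis s - cis t)); last by ring.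
    by rewrite (le_lt_trans (le_normcD _ _))// [ltRHS]splitr ltrD// (lt_trans vs).
  rewrite (_ : phi v - _ = (phi (cis t) - phi (cis s)) - (phi (cis t) - phi v));
    last by ring.
  by rewrite (le_trans (ler_normB _ _))//; lra.
move=> /(filterI (nbhs_right_gt 0)) /filter_ex[delta [d0 hd]].
exists delta => // u v /cis_onto[t tpi <-] h.
by apply: (hd t) => //=; rewrite in_itv.
Unshelve. all: by end_near. Qed.

End PlaneTopology.

Section Integrals.
Variables (R : realType) (phi : R[i] -> R).
Hypothesis cphi : continuous (phi : (R[i])^o -> R).
(** Test functions of arbitrary sign are reduced to this case in [roots_equidistribute_tame]. *)
Hypothesis phi0 : forall z, 0 <= phi z.

Lemma measurable_continuous_plane :
  measurable_fun [set: borelC R] (fun x : borelC R => (phi x)%:E).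
Proof.
apply/measurable_EFinP.
apply: (measurability _ (RGenOpens.measurableE R)).
move=> _ [_ [x [y ->]] <-]; rewrite setTI; apply: sub_sigma_algebra.
have oI : open `]x, y[%classic by exact: interval_open.
apply: (@open_comp (R[i])^o R phi) oI => t _; exact: cphi.
Qed.

Lemma integral_root_measure (f : {poly R[i]}) : f != 0 ->
  (\int[root_measure f]_x (phi x)%:E =
   ((size (poly_roots f))%:R^-1 * \sum_(z <- poly_roots f) phi z)%:E)%E.
Proof.
move=> f0; have mphi := measurable_continuous_plane.
have sz : size (poly_roots f) = (size f).-1.
  rewrite /poly_roots; case: closed_field_poly_normal => r /= ->.
  by rewrite size_scale ?lead_coef_eq0// size_prod_XsubC.
rewrite /root_measure ge0_integral_mscale//=; last by move=> x _; rewrite lee_fin.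
rewrite ge0_integral_measure_sum//; last by move=> x _; rewrite lee_fin.
rewrite EFinM sz; congr (_ * _)%E.
rewrite (big_nth 0) big_mkord sz -sumEFin; apply: eq_bigr => i _.
by rewrite integral_dirac// diracT mul1e.
Qed.

Lemma integral_circle_measure (I : R) :
  (\int[@lebesgue_measure R]_(t in `[0%R, (2 * pi)%R]) (phi (cis t))%:E = I%:E)%E ->
  (\int[circle_measure R]_x (phi x)%:E = ((2 * pi)^-1 * I)%:E)%E.
Proof.
move=> hI; have mphi := measurable_continuous_plane.
rewrite /circle_measure /distribution ge0_integral_pushforward//; last first.
  by move=> x _; rewrite lee_fin.
rewrite preimage_setT integral_uniform => [| |x]; last 2 first.
- by apply: measurableT_comp => //; exact: measurable_expi.
- by rewrite lee_fin.
by rewrite subr0 /= hI EFinM.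
Qed.
End Integrals.

(** * The equidistribution criterion *)

(** Moving the roots to the circle costs w for each near root and 2B for each of the at most 4 eta d
    others; [mean_unitize_le] then applies on the circle. *)
Lemma mean_roots_le (R : realType) (rs : seq R[i]) (S eta : R) (c M : nat)
    (phi : R[i] -> R) (B delta w : R) :
  let d := (size rs)%:R : R in let f := \prod_(z <- rs) ('X - z%:P) in
  0 < eta <= 4^-1 ->
  \sum_(i < (size rs).+1) normc f`_i <= S ->
  (size rs).+1%:R * S <= expR (eta ^+ 2 * d) ->
  c%:R <= eta * d -> (forall i, (i < c)%N -> f`_i = 0) ->
  expR (- (eta ^+ 2 * d)) <= normc f`_c ->
  (0 < M)%N -> 0 < delta -> 2 * eta < delta -> 0 <= w ->
  (forall z, `|phi z| <= B) ->
  (forall u v, normc u = 1 -> normc (v - u) < delta -> `|phi v - phi u| <= w) ->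
  `|\sum_(z <- rs) phi z - d / M%:R * \sum_(j < M) phi (zeta R M ^+ j)| <=
  d * (2 * w + 8 * B / (M%:R * delta ^+ 2) + (8 * B + M%:R * B * (12 + 2 * M%:R)) * eta).
Proof.
move=> d f eta_bd hS S_le c_le low fc M0 delta0 eta_delta w0 phiB hphi.
have /andP[e0 e4] := eta_bd.
have B0 : 0 <= B by rewrite (le_trans _ (phiB 0)).
have d0 : 0 <= d by [].
have h1 : `|\sum_(z <- rs) phi z - \sum_(z <- rs) phi (unitize z)| <=
    d * w + 2 * B * (4 * eta * d).
  rewrite -sumrB (le_trans (ler_norm_sum _ _ _))//.
  apply: (@le_trans _ _ (\sum_(z <- rs) (w + 2 * B * (off_circle eta z)%:R))).
    apply: ler_sum => z _; have [h|h] := boolP (off_circle eta z).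
      rewrite mulr1 (le_trans (ler_normB _ _))//.
      have := phiB z; have := phiB (unitize z); lra.
    rewrite mulr0 addr0; apply: hphi; first exact: normc_unitize.
    by rewrite (le_lt_trans (dist_unitize eta_bd h)).
  rewrite big_split/= -mulr_sumr lerD//.
    by rewrite big_const_seq count_predT iter_addr_0 -[leLHS]mulr_natl.
  apply: ler_wpM2l; first by rewrite mulr_ge0.
  exact: off_circle_le eta_bd hS S_le c_le low fc.
have K0 : 0 <= 12 + 2 * M%:R :> R by rewrite addr_ge0// mulr_ge0.
have T0 : 0 <= (12 + 2 * M%:R) * eta * d.
  by rewrite mulr_ge0// mulr_ge0// ltW.
have powT k : (0 < k < M)%N ->
    normc (\sum_(z <- rs) unitize z ^+ k) <= (12 + 2 * M%:R) * eta * d.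
  move=> /andP[k0 kM].
  apply: (le_trans (unit_power_sum eta_bd hS S_le c_le low fc k0)).
  rewrite -!mulrA; apply: ler_wpM2r; first by rewrite mulr_ge0// ltW.
  by rewrite lerD2l ler_wpM2l// ler_nat ltnW.
have h2 := mean_unitize_le M0 delta0 w0 phiB hphi T0 powT.
rewrite -(subrKA (\sum_(z <- rs) phi (unitize z))) (le_trans (ler_normD _ _))//.
apply: (le_trans (lerD h1 h2)); rewrite -/d le_eqVlt; apply/orP; left; apply/eqP.
ring.
Qed.

Section Criterion.
Variables (R : realType) (f : nat -> {poly R[i]}).

(* Subexponential size of the coefficients relative to the leading one, and a
   lowest nonzero coefficient which is neither of high index nor too small. *)
Definition tame (e : R) (p : {poly R[i]}) : Prop :=
  let d := (size p).-1 in
  [/\ (0 < d)%N,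
     d.+1%:R * \sum_(i < d.+1) normc p`_i <= expR (e * d%:R) * normc (lead_coef p) &
     exists c, [/\ c%:R <= e * d%:R, forall i, (i < c)%N -> p`_i = 0 &
       expR (- (e * d%:R)) * normc (lead_coef p) <= normc p`_c]].

Hypothesis tame_f : forall e : R, 0 < e < 1 -> \forall n \near \oo, tame e (f n).

Let mean phi n : R :=
  (size (poly_roots (f n)))%:R^-1 * \sum_(z <- poly_roots (f n)) phi z.

Lemma mean_cvg (phi : R[i] -> R) (B I : R) :
  continuous (phi : (R[i])^o -> R) -> (forall z, `|phi z| <= B) ->
  (\int[@lebesgue_measure R]_(t in `[0%R, (2 * pi)%R]) (phi (cis t))%:E = I%:E)%E ->
  mean phi n @[n --> \oo] --> (2 * pi)^-1 * I.
Proof.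
move=> cphi phiB hI; apply/cvgrPdist_le => /= e e0.
have B0 : 0 <= B by rewrite (le_trans _ (phiB 0)).
have e8 : 0 < e / 8 by rewrite divr_gt0.
have [delta delta0 hphi] := unif_continuous_circle cphi e8.
have /nbhs_normP[tau tau0 htau] := continuous_cis (0 : R) delta0.
have pi2 := two_pi_gt0 R.
(* One summand controls the Fejer tail, the other the step of the Riemann sum. *)
pose M := (Num.bound (8 * B / (e / 8 * delta ^+ 2)) + Num.bound (2 * pi / tau)).+1.
have hM1 : 8 * B / (M%:R * delta ^+ 2) <= e / 8.
  have d2 : 0 < delta ^+ 2 by rewrite exprn_gt0.
  rewrite ler_pdivrMr ?mulr_gt0 ?ltr0n// mulrCA -ler_pdivrMr ?mulr_gt0//.
  apply/ltW/(lt_le_trans (archi_boundP _)).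
    by rewrite !mulr_ge0// invr_ge0 mulr_ge0// ltW.
  by rewrite ler_nat /M leqW// leq_addr.
have hM2 : 2 * pi / M%:R < tau.
  rewrite ltr_pdivrMr ?ltr0n// [ltRHS]mulrC -ltr_pdivrMr//.
  apply: (lt_le_trans (archi_boundP _)); first by apply: divr_ge0; exact: ltW.
  by rewrite ler_nat /M leqW// leq_addl.
have M0 : (0 < M)%N by [].
pose K := 8 * B + M%:R * B * (12 + 2 * M%:R) + 1.
have K0 : 0 < K by rewrite ltr_wpDl// addr_ge0 ?mulr_ge0// addr_ge0 ?mulr_ge0.
(* Chosen after M, on which the constant K of the error depends. *)
pose eta := Num.min (4^-1) (Num.min (delta / 4) (e / 8 / K)).
have eta0 : 0 < eta by rewrite !lt_min invr_gt0 ltr0n/= !divr_gt0.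
have eta4 : eta <= 4^-1 by rewrite ge_min lexx.
have eta_delta : 2 * eta < delta.
  have : eta <= delta / 4 by rewrite !ge_min lexx orbT.
  lra.
have eta_K : K * eta <= e / 8.
  by rewrite mulrC -ler_pdivlMr// !ge_min lexx !orbT.
have cg : continuous (fun t : R => phi (cis t)).
  by move=> t; apply: (@continuous_comp R (R[i])^o R (@cis R) phi);
    [exact: continuous_expi|exact: cphi].
have hw s t : 0 <= s -> s <= t -> t <= s + 2 * pi / M%:R ->
    `|phi (cis t) - phi (cis s)| <= e / 8.
  move=> s0 st ts; apply: hphi; first exact: normc_cis.
  rewrite -[t](subrK s) cisD -[X in _ - X]mul1r -mulrBl normcM normc_cis mulr1.
  rewrite -cis0; apply: htau; rewrite /ball_ /= sub0r normrN ger0_norm ?subr_ge0//.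
  by rewrite (le_lt_trans _ hM2)// lerBlDl.
have [I' hI' hR] := riemann_sum_le cg pi2 M0 hw.
have II : I' = I by apply: EFin_inj; rewrite -hI' -hI.
rewrite {}II in hR.
have e2 : 0 < eta ^+ 2 < 1 by rewrite exprn_gt0//=; nra.
near=> n.
have [d0 hS [c [hc low fc]]] : tame (eta ^+ 2) (f n) by near: n; exact: tame_f.
pose rs := poly_roots (f n).
have f0 : f n != 0 by apply/eqP => f0; move: d0; rewrite f0 size_poly0.
have l0 : 0 < normc (lead_coef (f n)) by rewrite normc_gt0// lead_coef_eq0.
have fE : f n = lead_coef (f n) *: \prod_(z <- rs) ('X - z%:P).
  by rewrite /rs /poly_roots; case: closed_field_poly_normal.
have sz : size rs = (size (f n)).-1.
  by rewrite [in RHS]fE size_scale ?lead_coef_eq0// size_prod_XsubC.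
have coefE i : (\prod_(z <- rs) ('X - z%:P))`_i = (f n)`_i / lead_coef (f n).
  have h : (f n)`_i = lead_coef (f n) * (\prod_(z <- rs) ('X - z%:P))`_i.
    by rewrite -coefZ -fE.
  by rewrite h mulrAC mulfV ?mul1r// lead_coef_eq0.
rewrite -sz in d0 hS hc fc.
have nE i : normc (\prod_(z <- rs) ('X - z%:P))`_i =
    normc (f n)`_i / normc (lead_coef (f n)) by rewrite coefE normcM normcV.
have dr0 : 0 < (size rs)%:R :> R by rewrite ltr0n.
have e_le : eta ^+ 2 <= eta by rewrite expr2 ler_piMl ?ltW//; lra.
have hf := @mean_roots_le R rs _ eta c M phi B delta (e / 8) _ (lexx _).
have {hf} : `|\sum_(z <- rs) phi z -
     (size rs)%:R / M%:R * \sum_(j < M) phi (zeta R M ^+ j)| <=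
   (size rs)%:R * (2 * (e / 8) + 8 * B / (M%:R * delta ^+ 2) +
    (8 * B + M%:R * B * (12 + 2 * M%:R)) * eta).
  apply: hf => //.
  - by rewrite eta0.
  - rewrite (eq_bigr (fun i : 'I_(size rs).+1 => normc (f n)`_i / normc (lead_coef (f n)))).
      by rewrite -mulr_suml mulrA ler_pdivrMr.
    by move=> i _; exact: nE.
  - by rewrite (le_trans hc)// ler_wpM2r.
  - by move=> i /low hi; rewrite coefE hi mul0r.
  - by rewrite nE ler_pdivlMr.
  - exact: ltW.
have zE : \sum_(j < M) phi (zeta R M ^+ j) =
    \sum_(j < M) phi (cis (2 * pi * j%:R / M%:R)).
  by apply: eq_bigr => j _; rewrite zetaX.
rewrite {}zE; set Z := \sum_(j < M) _ in hR *; set s := \sum_(z <- rs) _ => hs.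
set d := (size rs)%:R in dr0 hs.
have hs' : `|d^-1 * s - M%:R^-1 * Z| <= 2 * (e / 8) + 8 * B / (M%:R * delta ^+ 2) +
    (8 * B + M%:R * B * (12 + 2 * M%:R)) * eta.
  move: hs; set E := _ + _ * eta => hs.
  rewrite -(ler_pM2l dr0) -[X in X * `|_|](gtr0_norm dr0) -normrM mulrBr !mulrA.
  by rewrite mulfV ?gt_eqF// mul1r; exact: hs.
rewrite (_ : _ - mean phi n = ((2 * pi)^-1 * I - M%:R^-1 * Z) - (d^-1 * s - M%:R^-1 * Z));
  last by rewrite /mean -/rs -/s -/d; ring.
apply: (le_trans (ler_normB _ _)).
have := lerD hR hs'; have := eta_K; rewrite /K mulrDl mul1r.
by move: hM1 eta0; lra.
Unshelve. all: by end_near. Qed.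

Let tame_neq0 n : tame (1 / 2) (f n) -> f n != 0.
Proof. by move=> [d0 _ _]; apply/eqP => f0; move: d0; rewrite f0 size_poly0. Qed.

Lemma integral_cvg_ge0 (phi : R[i] -> R) (B : R) :
  continuous (phi : (R[i])^o -> R) -> (forall z, 0 <= phi z) ->
  (forall z, phi z <= B) -> exists2 l : R,
    (\int[circle_measure R]_x (phi x)%:E = l%:E)%E &
    (\int[root_measure (f n)]_x (phi x)%:E)%E @[n --> \oo] --> l%:E.
Proof.
move=> cphi phi0 phiB.
have cg : continuous (fun t : R => phi (cis t)).
  by move=> t; apply: (@continuous_comp R (R[i])^o R (@cis R) phi);
    [exact: continuous_expi|exact: cphi].
(* The one-point Riemann sum, for the finiteness of the integral only. *)
have hw s t : 0 <= s -> s <= t -> t <= s + 2 * pi / 1%:R ->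
    `|phi (cis t) - phi (cis s)| <= 2 * B.
  move=> _ _ _; rewrite (le_trans (ler_normB _ _))// !ger0_norm//.
  by rewrite mulr_natl mulr2n lerD.
have [I hI _] := riemann_sum_le cg (two_pi_gt0 R) (isT : (0 < 1)%N) hw.
exists ((2 * pi)^-1 * I); first exact: integral_circle_measure.
have hm := @mean_cvg phi B I cphi (fun z => _) hI.
have {}hm : mean phi n @[n --> \oo] --> (2 * pi)^-1 * I.
  by apply: hm => z; rewrite ger0_norm.
have : (mean phi n)%:E @[n --> \oo] --> ((2 * pi)^-1 * I)%:E.
  by apply: cvg_EFin hm; exact: nearW.
apply: cvg_trans; apply: near_eq_cvg; near=> n.
rewrite integral_root_measure//; apply: tame_neq0; near: n.
by apply: tame_f; lra.
Unshelve. all: by end_near. Qed.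

(** The positive and negative parts are continuous, bounded and nonnegative; their limits are
    finite, so the difference converges. *)
Lemma roots_equidistribute_tame : roots_equidistribute f.
Proof.
move=> phi cphi [B [_ hB]].
have {}hB z : `|phi z| <= B + 1 by apply: (hB (B + 1)); rewrite ?ltrDl.
pose pos z : R := Num.max (phi z) 0.
pose neg z : R := Num.max (- phi z) 0.
have cmax (h : R[i] -> R) : continuous (h : (R[i])^o -> R) ->
    continuous ((fun z => Num.max (h z) 0) : (R[i])^o -> R).
  by move=> ch z; apply: continuous_max; [exact: ch|exact: cst_continuous].
have [lp hp cp] := @integral_cvg_ge0 pos (B + 1) (cmax _ cphi)
  (fun z => ltac:(by rewrite le_max lexx orbT))
  (fun z => ltac:(by rewrite ge_max (le_trans (ler_norm _) (hB z)) (le_trans _ (hB z)))).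
have cN : continuous ((fun z => - phi z) : (R[i])^o -> R).
  by move=> z; apply: continuousN; exact: cphi.
have [ln hn cn] := @integral_cvg_ge0 neg (B + 1) (cmax _ cN)
  (fun z => ltac:(by rewrite le_max lexx orbT))
  (fun z => ltac:(by rewrite ge_max (le_trans (ler_norm _) _) ?normrN ?hB//
                     (le_trans _ (hB z)))).
have split (mu : {measure set (borelC R) -> \bar R}) :
    (\int[mu]_x (phi x)%:E = \int[mu]_x (pos x)%:E - \int[mu]_x (neg x)%:E)%E.
  rewrite integralE; congr (_ - _)%E; apply: eq_integral => x _.
    by rewrite funeposE /pos EFin_max.
  by rewrite funenegE /neg EFin_max EFinN.
rewrite split hp hn; under eq_fun do rewrite split.
exact: cvgeB cp cn.
Qed.

End Criterion.

(** * The spt-crank polynomials *)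

Lemma normc_int (R : realType) (k : int) : normc (k%:~R : R[i]) = `|k%:~R|.
Proof. by rewrite -(rmorph_int (real_complex R)) normc_real. Qed.

Lemma coef_P_ (R : realType) n i : (0 < n)%N -> (P_ R n)`_i =
  if (i < n)%N then (N_S i%:Z n)%:~R / (if i == 0%N then 2 else 1) else 0.
Proof.
move=> n0; rewrite /P_ coefD coefC coef_sum big_nat.
under eq_bigr do rewrite coefZ coefXn.
have [->|i0] := eqVneq i 0%N.
  rewrite n0 big1 ?addr0// => m /andP[m0 _].
  by rewrite ltn_eqF// mulr0.
rewrite add0r divr1; case: ltnP => ni; last first.
  by rewrite big1// => m /andP[_ mn]; rewrite gtn_eqF ?mulr0// (leq_trans mn).
rewrite -big_nat (bigD1_seq i)/= ?mem_index_iota ?iota_uniq ?lt0n ?i0//.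
rewrite eqxx mulr1 big1 ?addr0// => m mi.
by rewrite eq_sym (negPf mi) mulr0.
Qed.

Lemma tame_P_ (R : realType) (e : R) : 0 < e < 1 ->
  \forall n \near \oo, tame e (P_ R n).
Proof.
move=> /andP[e0 e1]; have e4 : 0 < e / 4 by rewrite divr_gt0.
have big : \forall n \near \oo, ((Num.bound (8 / e ^+ 2)).+2 <= n)%N.
  exact: nbhs_infty_ge.
apply: filterS3 (N_S_subexp e4) (poly_le_exp 1 e4) big => n hNS hpoly hbig.
have n2 : (2 <= n)%N by exact: leq_trans hbig.
have n1 : (n.-1.+1 = n)%N by rewrite prednK// (leq_trans _ n2).
set d : R := n.-1%:R.
have nd : n%:R <= 2 * d.
  by rewrite /d -natrM ler_nat -{1}n1; lia.
have d1 : 1 <= d by rewrite ler1n; lia.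
have hS : \sum_(m < n) `|(N_S m%:Z n)%:~R| <= expR (e / 2 * d) :> R.
  apply: (@le_trans _ _ (expR (e / 4 * n%:R))).
    exact: hNS.
  rewrite ler_expR; nra.
have hn : n%:R <= expR (e / 2 * d).
  apply: (@le_trans _ _ (1 * n.+1%:R ^+ 3)).
    by rewrite mul1r -natrX ler_nat; clear; nia.
  apply: (@le_trans _ _ (expR (e / 4 * n%:R))).
    exact: hpoly.
  by rewrite ler_expR; nra.
have hN : 8 / e ^+ 2 <= d.
  apply/ltW/(lt_le_trans (archi_boundP _)); first by rewrite divr_ge0// sqr_ge0.
  by rewrite ler_nat; clear -hbig; lia.
(* For large n, (m+1)^2 >= (e d)^2 >= 8d >= 2n, so N_S(m, n) > 0 and the lowest nonzero index is at
   most m <= e d. *)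
pose m := Num.truncn (e * d).
have ed0 : 0 <= e * d by rewrite mulr_ge0 ?ltW//; lra.
have m_le : m%:R <= e * d by rewrite truncn_le.
have m_gt : e * d < m.+1%:R by rewrite truncnS_gt.
have hm2 : (2 * n <= m.+1 ^ 2)%N.
  rewrite -(ler_nat R) natrM natrX.
  have : (e * d) ^+ 2 <= m.+1%:R ^+ 2 by rewrite lerXn2r ?nnegrE// ltW.
  move: hN; rewrite ler_pdivrMr ?exprn_gt0// exprMn => hN.
  have : 8 * d <= e ^+ 2 * d ^+ 2 by nra.
  by move: nd; lra.
have mn : (m < n)%N.
  by rewrite -n1 ltnS -(ler_nat R) -/d; nra.
have m0 : (0 < m)%N by case: (m) hm2 => //; clear -n2; lia.
have n0 : (0 < n)%N by exact: leq_trans n2.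
have nn : (0 < n.-1 < n)%N by clear -n2; lia.
have n2n : (2 * n <= n.-1.+1 ^ 2)%N.
  by clear -n2 n1; rewrite n1 expnS expn1 leq_mul2r n2 orbT.
have coefm i : (0 < i < n)%N -> (P_ R n)`_i = (N_S i%:Z n)%:~R.
  move=> /andP[i0 lin]; rewrite coef_P_ ?lin ?gtn_eqF ?divr1//.

have lead0 : (P_ R n)`_n.-1 != 0.
  rewrite coefm//.
  by rewrite intr_eq0 gt_eqF// N_S_gt0.
have sz : size (P_ R n) = n.
  apply/eqP; rewrite eqn_leq; apply/andP; split.
    by apply/leq_sizeP => i ni; rewrite coef_P_// ltnNge ni.
  by rewrite -{1}n1 ltnNge; apply: contra lead0 => /leq_sizeP ->.
have ncoef i : normc (P_ R n)`_i <= if (i < n)%N then `|(N_S i%:Z n)%:~R| else 0.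
  rewrite coef_P_//; case: ifP => _; last by rewrite normc0.
  rewrite normcM normc_int normcV; case: eqP => _.
    by rewrite normc_nat ler_piMr// invf_le1//; lra.
  by rewrite normc1 invr1 mulr1.
have leadE : lead_coef (P_ R n) = (N_S n.-1%:Z n)%:~R.
  by rewrite lead_coefE sz coefm.
have l1 : 1 <= normc (lead_coef (P_ R n)).
  rewrite leadE normc_int -[X in X <= _]/(1%:~R) -intr_norm ler_int.
  by rewrite gtr0_norm -?gtz0_ge1 N_S_gt0.
have l2 : normc (lead_coef (P_ R n)) <= expR (e / 2 * d).
  apply: le_trans hS; rewrite leadE normc_int.
  have nn' : (n.-1 < n)%N by rewrite n1.
  by rewrite (bigD1 (Ordinal nn'))//= lerDl sumr_ge0.
have ee : expR (e * d) = expR (e / 2 * d) * expR (e / 2 * d).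
  by rewrite -expRD; congr expR; field.
split; rewrite sz.
- by case/andP: nn.
- rewrite n1 -/d ee -[leLHS]mulr1.
  apply: ler_pM => //; last apply: ler_pM => //.
  + by rewrite mulr_ge0// sumr_ge0// => i _; rewrite normc_ge0.
  + by rewrite sumr_ge0// => i _; rewrite normc_ge0.
  + apply: le_trans hS; apply: ler_sum => i _.
    by have := ncoef i; rewrite ltn_ord.
have exc : exists i, (P_ R n)`_i != 0 by exists n.-1.
have [c c0 cmin] := ex_minnP exc.
have cm : (c <= m)%N.
  by apply: cmin; rewrite coefm ?m0// intr_eq0 gt_eqF// N_S_gt0 ?m0.
exists c; split.
- by rewrite (le_trans _ m_le)// ler_nat.
- by move=> i ic; apply/eqP; apply: contraLR ic => /cmin; rewrite -leqNgt.
(* A nonzero coefficient is a nonzero integer, or half of one at index 0. *)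
have nc : 2^-1 <= normc (P_ R n)`_c.
  have lcn : (c < n)%N by exact: leq_ltn_trans mn.
  move: c0; rewrite coef_P_// lcn mulf_eq0 negb_or intr_eq0 => /andP[N0 _].
  rewrite normcM normc_int normcV.
  have h1 : 1 <= `|(N_S c%:Z n)%:~R| :> R.
    by rewrite -[X in X <= _]/(1%:~R) -intr_norm ler_int -gtz0_ge1 normr_gt0.
  by case: eqP => _; rewrite ?normc_nat ?normc1 ?invr1; lra.
(* With E = exp (e d / 2), the leading coefficient is at most E, so the left side is at most 1 / E
   <= 1 / n <= 1/2. *)
apply: le_trans nc; rewrite -/d expRN ee mulrC ler_pdivrMr ?mulr_gt0 ?expR_gt0//.
apply: (le_trans l2); rewrite mulrA ler_peMl ?expR_ge0//.
have n2r : 2 <= n%:R :> R by rewrite ler_nat.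
by have := le_trans n2r hn; move: (expR _) => E; lra.
Qed.

Theorem theorem4p3 (R : realType) : roots_equidistribute (fun n => P_ R n).
Proof. by apply: roots_equidistribute_tame => e; exact: tame_P_. Qed.
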